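(* Let $(\Omega,\mathcal U)$ be an admissible pair in the bi-parameter setting, let $w\colon\mathbb N^2\to[0,\infty)$ be a nonzero admissible weight (nonincreasing in each variable with $\|w\|_{\mathrm{ft}}<\infty$), and put $$\kappa_w:=\frac1{160\|w\|_{\mathrm{ft}}},\qquad t_0:=\log(1+1/256).$$ Then there is a $1/8$-sparse subfamily $\mathcal G_0\subset\mathcal U$ such that $$\int_{\mathbb R^{d_1+d_2}}\bigl(e^{t_0\kappa_wH_w(x)}-1\bigr)dx\le\int_{\mathbb R^{d_1+d_2}}\bigl(e^{t_0h_{\mathcal G_0}(x)}-1\bigr)dx\le\frac1{16}|\operatorname{sh}(\mathcal G_0)|.$$ Consequently, $$\int_\Omega e^{t_0\kappa_wH_w(x)}\,dx\le\frac{17}{16}|\Omega|.$$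
   Context: $\mathbb N=\{0,1,2,\dots\}$; $|\cdot|$ is Lebesgue measure. Fix dyadic grids $\mathcal D^i$ of cubes in $\mathbb R^{d_i}$, $i=1,2$ (side lengths $2^k$, $k\in\mathbb Z$). $Q^{(k)}$ is the $k$th dyadic ancestor of a cube $Q$ (the cube of the same grid containing $Q$ with side length $2^k$ times that of $Q$). Bi-parameter setting: rectangles are $I=I^1\times I^2\in\mathcal D^1\times\mathcal D^2$. For $\Omega\subset\mathbb R^{d_1+d_2}$ measurable of finite measure, $\widetilde\Omega:=\{M1_\Omega>1/2\}$ with $Mf(x):=\sup_{R\in\mathcal D^1\times\mathcal D^2,\,x\in R}\frac1{|R|}\int_R|f|$. For a rectangle $I\subset\Omega$ and $i=1,2$, $I_i^{(k)}$ is obtained from $I$ by replacing only $I^i$ by $(I^i)^{(k)}$, and $e_i(I;\Omega):=\max\{k\ge0:I_i^{(k)}\subset\widetilde\Omega\}$. $(\Omega,\mathcal U)$ is an admissible pair if $\Omega$ is measurable with finite measure and $\mathcal U$ is a family of such rectangles, all contained in $\Omega$, which is incomparable: no member is contained in a different member. $W_w(I;\Omega):=w(e_1(I;\Omega),e_2(I;\Omega))$, $H_w(x):=\sum_{I\in\mathcal U}W_w(I;\Omega)1_I(x)$, and $\|w\|_{\mathrm{ft}}:=\sup_{N\ge0}\sum_{a=0}^Nw(a,N-a)$. $\operatorname{sh}(\mathcal G):=\bigcup_{I\in\mathcal G}I$ and $h_{\mathcal G}:=\sum_{I\in\mathcal G}1_I$. For $0<\eta\le1$, a family $\mathcal G$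 is $\eta$-sparse if there are pairwise disjoint measurable sets $E_I\subset I$, $I\in\mathcal G$, with $|E_I|\ge\eta|I|$. *)

(* Defs.v *)
From HB Require Import structures.
From mathcomp Require Import all_boot all_order all_algebra.
From mathcomp Require Import all_classical all_reals all_analysis.

Set Implicit Arguments.
Unset Strict Implicit.
Unset Printing Implicit Defensive.
Import Order.TTheory GRing.Theory Num.Theory.
Import numFieldNormedType.Exports.

Local Open Scope classical_set_scope.
Local Open Scope ring_scope.

Notation Rd R d := (d.-tuple (measurableTypeR R)).

Definition tcons (R : realType) (d : nat)
    (x : measurableTypeR R * Rd R d) : Rd R d.+1 := [tuple of x.1 :: x.2].

Lemma measurable_tcons (R : realType) (d : nat) :
  measurable_fun [set: measurableTypeR R * Rd R d] (@tcons R d).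
Proof. by apply: measurable_cons. Qed.

Definition lebesgue_cons (R : realType) (d : nat)
    (mu : {sigma_finite_measure set (Rd R d) -> \bar R}) :
    set (Rd R d.+1) -> \bar R :=
  pushforward (lebesgue_measure \x mu)%E (@tcons R d).

HB.instance Definition _ (R : realType) (d : nat)
    (mu : {sigma_finite_measure set (Rd R d) -> \bar R}) :=
  Measure.copy (lebesgue_cons mu)
    (measure_function_pushforward__canonical__measure_function_Measure
      (lebesgue_measure \x mu)%E (@measurable_tcons R d)).

Lemma sigma_finite_product d1 d2 (T1 : measurableType d1)
    (T2 : measurableType d2) (R : realType)
    (m1 : {sigma_finite_measure set T1 -> \bar R})
    (m2 : {sigma_finite_measure set T2 -> \bar R}) :
  sigma_finite setT (m1 \x m2)%E.
Proof.
have /sigma_finiteP[F [TF ndF Foo]] := sigma_finiteT m1.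
have /sigma_finiteP[G [TG ndG Goo]] := sigma_finiteT m2.
exists (fun n => F n `*` G n).
  rewrite -setXTT TF TG predeqE => -[x y]; split.
    move=> [/= [n _ Fnx] [k _ Gky]]; exists (maxn n k) => //; split.
    - by move: x Fnx; exact/subsetPset/ndF/leq_maxl.
    - by move: y Gky; exact/subsetPset/ndG/leq_maxr.
  by move=> [n _ []/= ? ?]; split; exists n.
move=> k; have [? ?] := Foo k; have [? ?] := Goo k.
split; first exact: measurableX.
by rewrite product_measure1E// lte_mul_pinfty// ge0_fin_numE.
Qed.

Lemma lebesgue_cons_sigma_finite (R : realType) (d : nat)
    (mu : {sigma_finite_measure set (Rd R d) -> \bar R}) :
  sigma_finite setT (lebesgue_cons mu).
Proof.
have [F FT mF] := sigma_finite_product (@lebesgue_measure R) mu.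
pose g (x : Rd R d.+1) : measurableTypeR R * Rd R d :=
  (thead x, [tuple of behead x]).
have mg : measurable_fun setT g.
  apply/measurable_fun_pairP; split; first exact: measurable_tnth.
  exact: measurable_behead.
exists (fun n => g @^-1` F n).
  by rewrite -preimage_bigcup -FT preimage_setT.
move=> n; have [mFn Fn] := mF n; split.
  by rewrite -[X in measurable X]setTI; exact: mg.
rewrite /lebesgue_cons /pushforward -comp_preimage.
suff -> : g \o @tcons R d = id by [].
apply/funext => -[x y]; rewrite /g /tcons /=; congr (_, _).
exact/val_inj.
Qed.

HB.instance Definition _ (R : realType) (d : nat)
    (mu : {sigma_finite_measure set (Rd R d) -> \bar R}) :=
  Measure_isSigmaFinite.Build _ _ _ (lebesgue_cons mu)
    (lebesgue_cons_sigma_finite mu).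

Fixpoint lebesgue_Rd (R : realType) (d : nat) :
    {sigma_finite_measure set (Rd R d) -> \bar R} :=
  match d with
  | 0 => \d_ [tuple of (@nil (measurableTypeR R))]
  | d'.+1 => lebesgue_cons (lebesgue_Rd R d')
  end.

(* R^(d1 + d2) as R^d1 x R^d2 with the completed product measure: the
   measurable sets are the Lebesgue measurable ones, not only the Borel ones. *)
Notation Rprod R d1 d2 :=
  (caratheodory_type (lebesgue_Rd R d1 \x lebesgue_Rd R d2)%E^*%mu).

Definition lebesgue_Rprod (R : realType) (d1 d2 : nat) :
    {measure set (Rprod R d1 d2) -> \bar R} :=
  @completed_measure_extension _ _ _ (lebesgue_Rd R d1 \x lebesgue_Rd R d2)%E.

Definition is_cube (R : realType) (d : nat) (k : int) (Q : set (Rd R d)) :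
    Prop :=
  exists a : Rd R d,
    Q = [set x : Rd R d | forall i, tnth a i <= tnth x i < tnth a i + 2 ^ k].

Record dyadic_grid (R : realType) (d : nat) (D : set (set (Rd R d))) : Prop := {
  grid_cube : forall Q, D Q -> exists k : int, is_cube k Q;
  grid_partition : forall (k : int) x, exists! Q, [/\ D Q, is_cube k Q & Q x];
  grid_nested : forall Q P, D Q -> D P ->
    [\/ Q `<=` P, P `<=` Q | Q `&` P = set0]
}.

(* The set below is a singleton when D is a dyadic grid, Q is in D and 0 < d;
   set0 is the value of xget on the empty set. *)
Definition ancestor (R : realType) (d : nat) (D : set (set (Rd R d))) (k : nat)
    (Q : set (Rd R d)) : set (Rd R d) :=
  xget set0 [set P | [/\ D P, Q `<=` P &
    exists j : int, is_cube j Q /\ is_cube (j + k%:Z) P]].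

(* A rectangle is the pair of its sides: cubes are nonempty, so that the
   rectangles of D1 x D2 and the subsets they define correspond bijectively. *)
Notation rect R d1 d2 := (set (Rd R d1) * set (Rd R d2))%type.

Definition rset (R : realType) (d1 d2 : nat) (I : rect R d1 d2) :
    set (Rprod R d1 d2) := I.1 `*` I.2.

Definition sh (R : realType) (d1 d2 : nat) (G : set (rect R d1 d2)) :
    set (Rprod R d1 d2) := \bigcup_(I in G) rset I.

Definition maximal (R : realType) (d1 d2 : nat) (D1 : set (set (Rd R d1)))
    (D2 : set (set (Rd R d2))) (f : Rprod R d1 d2 -> R)
    (x : Rprod R d1 d2) : \bar R :=
  ereal_sup [set (\int[lebesgue_Rprod R d1 d2]_(y in rset J) `|f y|%:E
                  / lebesgue_Rprod R d1 d2 (rset J))%E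
            | J in [set J | (D1 `*` D2) J /\ rset J x]].

Definition enlarged (R : realType) (d1 d2 : nat) (D1 : set (set (Rd R d1)))
    (D2 : set (set (Rd R d2))) (Omega : set (Rprod R d1 d2)) :
    set (Rprod R d1 d2) :=
  [set x | (2^-1%:E < maximal D1 D2 \1_Omega x)%E].

Definition set_max (A : set nat) : nat :=
  xget 0 [set m | A m /\ forall k, A k -> (k <= m)%N].

(* These sets are bounded when I is contained in Omega and Omega has finite
   measure, since then the enlarged set also has finite measure; the default
   value of set_max is irrelevant. *)
Definition embed1 (R : realType) (d1 d2 : nat) (D1 : set (set (Rd R d1)))
    (D2 : set (set (Rd R d2))) (I : rect R d1 d2)
    (Omega : set (Rprod R d1 d2)) : nat :=
  set_max [set k | rset (ancestor D1 k I.1, I.2) `<=` enlarged D1 D2 Omega].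

Definition embed2 (R : realType) (d1 d2 : nat) (D1 : set (set (Rd R d1)))
    (D2 : set (set (Rd R d2))) (I : rect R d1 d2)
    (Omega : set (Rprod R d1 d2)) : nat :=
  set_max [set k | rset (I.1, ancestor D2 k I.2) `<=` enlarged D1 D2 Omega].

Record admissible_pair (R : realType) (d1 d2 : nat) (D1 : set (set (Rd R d1)))
    (D2 : set (set (Rd R d2))) (Omega : set (Rprod R d1 d2))
    (U : set (rect R d1 d2)) : Prop := {
  adm_measurable : measurable Omega;
  adm_finite : (lebesgue_Rprod R d1 d2 Omega < +oo)%E;
  adm_rect : U `<=` D1 `*` D2;
  adm_sub : forall I, U I -> rset I `<=` Omega;
  adm_incomparable : forall I J, U I -> U J -> rset I `<=` rset J -> I = J
}.

Definition sparse (R : realType) (d1 d2 : nat) (eta : R)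
    (G : set (rect R d1 d2)) : Prop :=
  exists E : rect R d1 d2 -> set (Rprod R d1 d2),
    trivIset G E /\
    forall I, G I -> [/\ measurable (E I), E I `<=` rset I &
      (eta%:E * lebesgue_Rprod R d1 d2 (rset I)
        <= lebesgue_Rprod R d1 d2 (E I))%E].

Definition ft_norm (R : realType) (w : nat -> nat -> R) : \bar R :=
  ereal_sup (range (fun N => (\sum_(0 <= a < N.+1) w a (N - a)%N)%:E)).

Record admissible_weight (R : realType) (w : nat -> nat -> R) : Prop := {
  weight_ge0 : forall a b, 0 <= w a b;
  weight_nincr1 : forall a a' b, (a <= a')%N -> w a' b <= w a b;
  weight_nincr2 : forall a b b', (b <= b')%N -> w a b' <= w a b;
  weight_fin : (ft_norm w < +oo)%E
}.

Definition kappa (R : realType) (w : nat -> nat -> R) : R :=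
  (160 * fine (ft_norm w))^-1.

Definition t0 (R : realType) : R := ln (1 + 256^-1).

Definition rect_weight (R : realType) (d1 d2 : nat) (D1 : set (set (Rd R d1)))
    (D2 : set (set (Rd R d2))) (w : nat -> nat -> R) (I : rect R d1 d2)
    (Omega : set (Rprod R d1 d2)) : R :=
  w (embed1 D1 D2 I Omega) (embed2 D1 D2 I Omega).

(* The sums over families of rectangles take values in [0, +oo]. *)
Definition H_ (R : realType) (d1 d2 : nat) (D1 : set (set (Rd R d1)))
    (D2 : set (set (Rd R d2))) (Omega : set (Rprod R d1 d2))
    (U : set (rect R d1 d2)) (w : nat -> nat -> R) (x : Rprod R d1 d2) :
    \bar R :=
  \esum_(I in U) (rect_weight D1 D2 w I Omega * \1_(rset I) x)%:E.

Definition h_ (R : realType) (d1 d2 : nat) (G : set (rect R d1 d2))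
    (x : Rprod R d1 d2) : \bar R :=
  \esum_(I in G) (\1_(rset I) x)%:E.

(* Main.v *)
Require Import Defs.
From mathcomp Require Import all_boot all_order all_algebra.
From mathcomp Require Import all_classical all_reals all_analysis.
From mathcomp Require Import measurable_realfun.
From mathcomp Require Import ring lra zify.
Set Implicit Arguments.
Unset Strict Implicit.
Unset Printing Implicit Defensive.
Import Order.TTheory GRing.Theory Num.Theory.
Import numFieldNormedType.Exports.
Local Open Scope classical_set_scope.
Local Open Scope ring_scope.

(** Exponentials of sums over a finite incomparable family V are products P of
    factors 1 + b_I 1_I. On a member I every other member that meets I depends
    on one variable only, so P = (1 + b_I) u(x_1) v(x_2) on I. If the average of
    u or of v were large for every I in V, the weak type inequality of the
    one-parameter maximal operators would give |sh V| <= 5 int (P - 1), which a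
    small Carleson constant forbids. So some I is light, with average of P at
    most 2 on I, and removing light rectangles one at a time yields
    int (P - 1) <= 2 sum b_I |I|.

    Sparseness is a Carleson condition for h_G0. For H_w it holds with constant
    4 ||w||_ft: in each variable half of I survives the removal of the members
    that stretch beyond its embedding, and on the product of these halves the
    m rectangles that survive at a point form a chain, the i-th of which has
    e_1 >= m - 1 - i and e_2 >= i, so that their weights sum to at most an
    antidiagonal sum of w. A greedy sparse subfamily G0 of a large finite part
    of U has |sh U| <= (160 / 9) |sh G0|, and h_G0 >= 1 on sh G0 supplies the
    mass that dominates the exponential of H_w. *)

(** * Covering inequalities *)

(** Duality with the strong maximal operator bounds the p-th norm of a Carleson sum only by a
    multiple of p^2, which does not give a linear exponent. Incomparability is what allows a
    reduction to the one-parameter maximal operators, whose weak type constant is 1 here.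

    The smallness that excludes a family without light rectangles is not given beforehand. It comes
    from the induction itself: the bound for V without one arbitrary member is so small that putting
    this member back cannot spoil it.

    The constants follow from this. A sparse family with b = exp t_0 - 1 = 1/256 has Carleson
    constant 8/256 = 1/32, and the factor 2 turns it into the 1/16 of the theorem. The number 160 in
    kappa_w makes the constant for H_w so small that, after the losses 2 and 160/9, it stays below
    1/256, which is a lower bound of exp (t_0 h_G0) - 1 on sh G0. *)

Record laminar {d} {T : measurableType d} {R : realType} (m : set T -> \bar R)
    (C : set (set T)) : Prop := {
  laminar_measurable : forall Q, C Q -> measurable Q;
  laminar_gt0 : forall Q, C Q -> (0 < m Q)%E;
  laminar_fin : forall Q, C Q -> (m Q < +oo)%E;
  laminar_nested : forall Q P, C Q -> C P ->
    [\/ Q `<=` P, P `<=` Q | Q `&` P = set0]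
}.

Section Covering.
Context {d : measure_display} {T : measurableType d} {R : realType}.
Variables (m : {measure set T -> \bar R}) (C : set (set T)).
Hypothesis lamC : laminar m C.
Local Open Scope ereal_scope.

Lemma measurable_laminar_cover (s : seq (set T)) :
  {in s, forall Q, C Q} -> measurable (\big[setU/set0]_(Q <- s) Q).
Proof.
move=> sC; rewrite big_seq; apply: bigsetU_measurable => Q /sC.
exact: (laminar_measurable lamC).
Qed.

(** A member contained in another one is dropped; otherwise the members inside Q are dropped, and Q
    is then disjoint from the rest. Keeping the integral on the union is what lets the two disjoint
    pieces be added. *)
Lemma laminar_cover_local (s : seq (set T)) (f : T -> \bar R) (a : R) :
  (0 <= a)%R -> measurable_fun setT f -> (forall x, 0 <= f x) ->
  {in s, forall Q, C Q /\ m Q <= a%:E * \int[m]_(x in Q) f x} ->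
  m (\big[setU/set0]_(Q <- s) Q) <=
    a%:E * \int[m]_(x in \big[setU/set0]_(Q <- s) Q) f x.
Proof.
move=> a0 mf f0; have [n] := ubnP (size s).
elim: n s => // n IHn [|Q s] /= sn sC.
  by rewrite big_nil measure0 integral_set0 mule0.
have {sn}sn : (size s < n)%N by [].
have [CQ Qf] := sC Q (mem_head _ _).
have sC' : {in s, forall P, C P /\ m P <= a%:E * \int[m]_(x in P) f x}.
  by move=> P Ps; apply: sC; rewrite inE Ps orbT.
rewrite big_cons.
have [[P Ps QP]|noP] := pselect (exists2 P, P \in s & Q `<=` P).
  rewrite [_ `|` _](_ : _ = \big[setU/set0]_(P <- s) P); first exact: IHn.
  apply/setUidPr; apply: (subset_trans QP).
  by rewrite (big_rem P Ps) /=; exact: subsetUl.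
pose s' := [seq P <- s | ~~ `[< P `<=` Q >]].
have s's P : P \in s' -> P \in s by rewrite mem_filter => /andP[].
have -> : Q `|` \big[setU/set0]_(P <- s) P = Q `|` \big[setU/set0]_(P <- s') P.
  rewrite -!bigcup_seq; apply/seteqP; split => x [Qx|[P /= Ps Px]].
  - by left.
  - have [PQ|nPQ] := pselect (P `<=` Q); first by left; exact: PQ.
    by right; exists P => //=; rewrite mem_filter Ps andbT; apply/asboolPn.
  - by left.
  - by right; exists P => //=; exact: s's.
have QP0 : [disjoint Q & \big[setU/set0]_(P <- s') P].
  apply/disj_setPS => x [Qx]; rewrite -bigcup_seq => -[P /= Ps' Px].
  move: Ps'; rewrite mem_filter => /andP[/asboolPn nPQ Ps].
  have [QP|//|QP0] := laminar_nested lamC CQ (sC' _ Ps).1.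
  - by apply: noP; exists P.
  - by have : (Q `&` P) x by []; rewrite QP0.
have mU : measurable (\big[setU/set0]_(P <- s') P).
  by apply: measurable_laminar_cover => P /s's/sC'[].
have mQ := laminar_measurable lamC CQ.
rewrite measureU//; last exact/disj_set2P.
rewrite ge0_integral_setU//; last exact: measurable_funTS.
rewrite ge0_muleDr; [|exact: integral_ge0|exact: integral_ge0].
apply: leeD => //; apply: IHn => [|P /s's/sC'//].
by apply: leq_ltn_trans sn; rewrite size_filter count_size.
Qed.

Lemma laminar_cover (s : seq (set T)) (f : T -> \bar R) (a : R) :
  (0 <= a)%R -> measurable_fun setT f -> (forall x, 0 <= f x) ->
  {in s, forall Q, C Q /\ m Q <= a%:E * \int[m]_(x in Q) f x} ->
  m (\big[setU/set0]_(Q <- s) Q) <= a%:E * \int[m]_x f x.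
Proof.
move=> a0 mf f0 sC; apply: le_trans (laminar_cover_local a0 mf f0 sC) _.
apply: lee_wpmul2l => //; apply: ge0_subset_integral => //.
by apply: measurable_laminar_cover => Q /sC[].
Qed.

End Covering.

(** For grid rectangles this is convertible to [sh] of the set of entries of V, so that estimates on
    abstract product spaces apply to [sh] directly. *)
Definition rect_cover {T1 T2 : Type} (V : seq (set T1 * set T2)) :
    set (T1 * T2) :=
  [set x | exists2 I, I \in V & I.1 x.1 /\ I.2 x.2].

Section ProductCovering.
Context {d1 d2 : measure_display} {T1 : measurableType d1}
  {T2 : measurableType d2} {R : realType}.
Variables (m1 : {sigma_finite_measure set T1 -> \bar R})
  (m2 : {sigma_finite_measure set T2 -> \bar R}).
Local Open Scope ereal_scope.
Implicit Types V : seq (set T1 * set T2).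

Lemma rect_coverE V :
  rect_cover V = \big[setU/set0]_(J <- V) (J.1 `*` J.2).
Proof. by rewrite -bigcup_seq; apply/seteqP; split => x [I IV]; exists I. Qed.

Lemma measurable_rect_cover V :
  {in V, forall I, measurable I.1 /\ measurable I.2} ->
  measurable (rect_cover V).
Proof.
move=> mV; rewrite rect_coverE big_seq; apply: bigsetU_measurable => I /mV[].
exact: measurableX.
Qed.

Lemma xsection_rect_cover V x :
  xsection (rect_cover V) x =
  \big[setU/set0]_(Q <- [seq J.2 | J <- V & `[< J.1 x >]]) Q.
Proof.
rewrite -bigcup_seq; apply/seteqP; split => y.
  move=> /xsectionP[I IV [/= Ix Iy]]; exists I.2 => //=; apply/mapP.
  by exists I => //; rewrite mem_filter IV andbT; apply/asboolP.
move=> [Q /= /mapP[I]]; rewrite mem_filter => /andP[/asboolP Ix IV] -> Iy.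
by apply/xsectionP; exists I.
Qed.

Lemma ysection_rect_cover V y :
  ysection (rect_cover V) y =
  \big[setU/set0]_(Q <- [seq J.1 | J <- V & `[< J.2 y >]]) Q.
Proof.
rewrite -bigcup_seq; apply/seteqP; split => x.
  move=> /ysectionP[I IV [/= Ix Iy]]; exists I.1 => //=; apply/mapP.
  by exists I => //; rewrite mem_filter IV andbT; apply/asboolP.
move=> [Q /= /mapP[I]]; rewrite mem_filter => /andP[/asboolP Iy IV] -> Ix.
by apply/ysectionP; exists I.
Qed.

Lemma product_measure_ysection (A : set (T1 * T2)) : measurable A ->
  (m1 \x m2) A = \int[m2]_y m1 (ysection A y).
Proof.
apply: (product_measure_unique (m' := (m1 \x^ m2))) => B D mB mD.
exact: product_measure2E.
Qed.

(** For fixed y the slice of the cover is a union of laminar sets I.1, to which [laminar_cover]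
    applies with F(., y); Tonelli then integrates in y. *)
Lemma rect_cover_le1 (C : set (set T1)) (lamC : laminar m1 C) V
    (F : T1 * T2 -> \bar R) (a : R) :
  (0 <= a)%R -> measurable_fun setT F -> (forall x, 0 <= F x) ->
  {in V, forall I, [/\ C I.1, measurable I.2 &
    forall y, I.2 y -> m1 I.1 <= a%:E * \int[m1]_(x in I.1) F (x, y)]} ->
  (m1 \x m2) (rect_cover V) <= a%:E * \int[m1 \x m2]_x F x.
Proof.
move=> a0 mF F0 VF.
have mV : measurable (rect_cover V).
  by apply: measurable_rect_cover => I /VF[/(laminar_measurable lamC)].
rewrite product_measure_ysection// fubini_tonelli2// -ge0_integralZl//; first last.
- by move=> y _; apply: integral_ge0.
- exact: measurable_fun_fubini_tonelli_G.
apply: ge0_le_integral => //.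
- exact: measurable_fun_ysection.
- by apply: measurable_funeM; exact: measurable_fun_fubini_tonelli_G.
move=> y _; rewrite ysection_rect_cover.
apply: (laminar_cover lamC) => //.
  exact: measurable_fun_pair1.
move=> Q /mapP[I]; rewrite mem_filter => /andP[/asboolP Iy /VF[CI _ IF]] ->.
by split => //; exact: IF.
Qed.

(** The side I.1 is allowed to be any measurable set because [strong_cover] shrinks it to a part of
    a cube before this variable is treated. *)
Lemma rect_cover_le2 (C : set (set T2)) (lamC : laminar m2 C) V
    (F : T1 * T2 -> \bar R) (a : R) :
  (0 <= a)%R -> measurable_fun setT F -> (forall x, 0 <= F x) ->
  {in V, forall I, [/\ measurable I.1, C I.2 &
    forall x, I.1 x -> m2 I.2 <= a%:E * \int[m2]_(y in I.2) F (x, y)]} ->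
  (m1 \x m2) (rect_cover V) <= a%:E * \int[m1 \x m2]_x F x.
Proof.
move=> a0 mF F0 VF.
have mV : measurable (rect_cover V).
  by apply: measurable_rect_cover => I /VF[? /(laminar_measurable lamC)].
rewrite fubini_tonelli1// -ge0_integralZl//; first last.
- by move=> y _; apply: integral_ge0.
- exact: measurable_fun_fubini_tonelli_F.
apply: ge0_le_integral => //.
- exact: measurable_fun_xsection.
- by apply: measurable_funeM; exact: measurable_fun_fubini_tonelli_F.
move=> x _ /=; rewrite xsection_rect_cover.
apply: (laminar_cover lamC) => //.
  exact: measurable_fun_pair2.
move=> Q /mapP[I]; rewrite mem_filter => /andP[/asboolP Ix /VF[_ CI IF]] ->.
by split => //; exact: IF.
Qed.

Lemma rect_cover_fibers1 (C : set (set T1)) (lamC : laminar m1 C) V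
    (B : set (T1 * T2)) (a : R) :
  (0 <= a)%R -> measurable B ->
  {in V, forall I, [/\ C I.1, measurable I.2 &
    forall y, I.2 y -> m1 I.1 <= a%:E * m1 (I.1 `&` ysection B y)]} ->
  (m1 \x m2) (rect_cover V) <= a%:E * (m1 \x m2) B.
Proof.
move=> a0 mB VB.
rewrite (_ : (m1 \x m2) B = \int[m1 \x m2]_x (\1_B x)%:E); last first.
  by rewrite integral_indic// setIT.
apply: (rect_cover_le1 lamC) => //.
  by apply/measurable_EFinP; exact: measurable_indic.
move=> I /VB[CI mI2 IB]; split => // y Iy; rewrite (_ : integral _ _ _ =
  \int[m1]_(x in I.1) (\1_(ysection B y) x)%:E); last first.
  by apply: eq_integral => x _; rewrite !indicE mem_ysection.
rewrite integral_indic//; first by rewrite setIC; exact: IB.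
- exact: (laminar_measurable lamC).
- exact: measurable_ysection.
Qed.

Lemma rect_cover_fibers2 (C : set (set T2)) (lamC : laminar m2 C) V
    (B : set (T1 * T2)) (a : R) :
  (0 <= a)%R -> measurable B ->
  {in V, forall I, [/\ measurable I.1, C I.2 &
    forall x, I.1 x -> m2 I.2 <= a%:E * m2 (I.2 `&` xsection B x)]} ->
  (m1 \x m2) (rect_cover V) <= a%:E * (m1 \x m2) B.
Proof.
move=> a0 mB VB.
rewrite (_ : (m1 \x m2) B = \int[m1 \x m2]_x (\1_B x)%:E); last first.
  by rewrite integral_indic// setIT.
apply: (rect_cover_le2 lamC) => //.
  by apply/measurable_EFinP; exact: measurable_indic.
move=> I /VB[mI1 CI IB]; split => // x Ix; rewrite (_ : integral _ _ _ =
  \int[m2]_(y in I.2) (\1_(xsection B x) y)%:E); last first.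
  by apply: eq_integral => y _; rewrite !indicE mem_xsection.
rewrite integral_indic//; first by rewrite setIC; exact: IB.
- exact: (laminar_measurable lamC).
- exact: measurable_xsection.
Qed.

End ProductCovering.

Section StrongCovering.
Context {d1 d2 : measure_display} {T1 : measurableType d1}
  {T2 : measurableType d2} {R : realType}.
Variables (m1 : {sigma_finite_measure set T1 -> \bar R})
  (m2 : {sigma_finite_measure set T2 -> \bar R}).
Variables (C1 : set (set T1)) (C2 : set (set T2)).
Hypotheses (lamC1 : laminar m1 C1) (lamC2 : laminar m2 C2).
Local Open Scope ereal_scope.

(* The strong maximal operator is dominated by the composition of the
   operators in the two variables: half of I being in B, the fibre of B fills a
   quarter of I.2 over a quarter of I.1. *)
Lemma quarter_fibers (I : set T1 * set T2) (B : set (T1 * T2)) :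
  C1 I.1 -> C2 I.2 -> measurable B ->
  (m1 \x m2) (I.1 `*` I.2) <= 2%:E * (m1 \x m2) ((I.1 `*` I.2) `&` B) ->
  exists A, [/\ measurable A, A `<=` I.1, m1 I.1 <= 4%:E * m1 A &
    forall x, A x -> m2 I.2 <= 4%:E * m2 (I.2 `&` xsection B x)].
Proof.
move=> CI1 CI2 mB.
have mI1 := laminar_measurable lamC1 CI1.
have mI2 := laminar_measurable lamC2 CI2.
have fI1 : m1 I.1 \is a fin_num.
  by rewrite ge0_fin_numE// (laminar_fin lamC1 CI1).
have fI2 : m2 I.2 \is a fin_num.
  by rewrite ge0_fin_numE// (laminar_fin lamC2 CI2).
set BI := (I.1 `*` I.2) `&` B.
have mBI : measurable BI by apply: measurableI => //; exact: measurableX.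
have sBI x : xsection BI x `<=` I.2 `&` xsection B x.
  by move=> y /xsectionP[[]] /= ? ? ?; split => //; exact/xsectionP.
have mf := measurable_fun_xsection m2 mBI.
pose A := I.1 `&` [set x | m2 I.2 <= 4%:E * m2 (xsection BI x)].
have mA : measurable A.
  apply: measurable_lee => //; apply: measurable_funTS => //.
  exact: measurable_funeM.
move=> le2; exists A; split => // [x [] //||x [_] /le_trans]; last first.
  by apply; rewrite lee_wpmul2l// le_measure ?inE//;
     [exact: measurable_xsection|
      apply: measurableI => //; exact: measurable_xsection].
have fA : m1 A \is a fin_num.
  rewrite ge0_fin_numE//; apply: le_lt_trans (laminar_fin lamC1 CI1).
  by rewrite le_measure ?inE// => x [].
(* A fibre of [BI] has measure at most that of I.2 over A and less than a quarter of it elsewhere.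
   Since [BI] has at least half the measure of I, A has at least 1/2 - 1/4 of that of I.1. *)
have : (m1 \x m2) BI <= m2 I.2 * m1 A + 4^-1%:E * m2 I.2 * m1 I.1.
  rewrite -[in X in _ <= _ * X + _](setIT A) -[X in _ <= _ + _ * m1 X]setIT.
  rewrite -!(integral_indic m1 measurableT)// -!ge0_integralZl//; first last.
  - by apply/measurable_EFinP; exact: measurable_indic.
  - by rewrite mule_ge0.
  - by apply/measurable_EFinP; exact: measurable_indic.
  rewrite -ge0_integralD//; first last.
  - by apply: measurable_funeM; apply/measurable_EFinP; exact: measurable_indic.
  - by move=> x _; rewrite !mule_ge0.
  - by apply: measurable_funeM; apply/measurable_EFinP; exact: measurable_indic.
  - by move=> x _; rewrite mule_ge0.
  apply: ge0_le_integral => //.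
  - apply: emeasurable_funD; apply: measurable_funeM;
      by apply/measurable_EFinP; exact: measurable_indic.
  move=> x _ /=.
  have [Ix|nIx] := pselect (I.1 x); last first.
    rewrite [xsection BI x](_ : _ = set0) ?measure0.
      by rewrite adde_ge0// !mule_ge0.
    by apply/seteqP; split => // y /xsectionP[[]].
  have le_I2 : m2 (xsection BI x) <= m2 I.2.
    rewrite le_measure ?inE//; first exact: measurable_xsection.
    by move=> y /sBI[].
  rewrite [\1_I.1 x]indicE mem_set// mule1.
  have [Ax|nAx] := pselect (A x).
    by rewrite indicE mem_set// mule1 (le_trans le_I2)// leeDl// mule_ge0.
  rewrite indicE memNset// mule0 add0e.
  have : 4%:E * m2 (xsection BI x) < m2 I.2.
    by rewrite ltNge; apply/negP => ?; exact: nAx.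
  have fBI : m2 (xsection BI x) \is a fin_num.
    by rewrite ge0_fin_numE// (le_lt_trans le_I2)// (laminar_fin lamC2 CI2).
  rewrite -(fineK fBI) -(fineK fI2) -!EFinM lte_fin lee_fin => lt4.
  by rewrite [leRHS]mulrC ler_pdivlMr// mulrC; exact: ltW.
move: le2; have -> : (m1 \x m2) (I.1 `*` I.2) = m1 I.1 * m2 I.2.
  exact: product_measure1E.
have fBI : (m1 \x m2) BI \is a fin_num.
  rewrite ge0_fin_numE//; apply: (@le_lt_trans _ _ (m1 I.1 * m2 I.2)).
    rewrite -product_measure1E// le_measure ?inE//; first exact: measurableX.
    by move=> x [].
  by rewrite ltey_eq fin_numM.
have : 0 < m2 I.2 := laminar_gt0 lamC2 CI2.
rewrite -(fineK fBI) -(fineK fI2) -(fineK fA) -(fineK fI1).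
rewrite -!EFinM -EFinD !lee_fin lte_fin => p2 le1 le2.
rewrite -(ler_pM2r p2); lra.
Qed.

(** The rectangles A J times J.2 are the intermediate object: their cover fills a quarter of J.1 on
    each horizontal line through J, and B fills a quarter of each of their vertical fibres. Each
    passage costs a factor 4. *)
Lemma strong_cover (V : seq (set T1 * set T2)) (B : set (T1 * T2)) :
  measurable B ->
  {in V, forall I, [/\ C1 I.1, C2 I.2 &
    (m1 \x m2) (I.1 `*` I.2) <= 2%:E * (m1 \x m2) ((I.1 `*` I.2) `&` B)]} ->
  (m1 \x m2) (rect_cover V) <= 16%:E * (m1 \x m2) B.
Proof.
move=> mB VB.
have /choice[A VA] I : exists A, I \in V ->
    [/\ measurable A, A `<=` I.1, m1 I.1 <= 4%:E * m1 A &
    forall x, A x -> m2 I.2 <= 4%:E * m2 (I.2 `&` xsection B x)].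
  have [/VB[CI1 CI2 IB]|] := boolP (I \in V); last by exists set0.
  by have [A ?] := quarter_fibers CI1 CI2 mB IB; exists A.
pose V' := [seq (A J, J.2) | J <- V].
have mV' : measurable (rect_cover V').
  apply: measurable_rect_cover => Q /mapP[I IV ->] /=.
  by have [] := VA _ IV; have [_ /(laminar_measurable lamC2)] := VB _ IV.
have le1 : (m1 \x m2) (rect_cover V) <= 4%:E * (m1 \x m2) (rect_cover V').
  apply: (rect_cover_fibers1 m2 lamC1) => //.
  move=> I IV; have [CI1 CI2 _] := VB _ IV; have [mA sA leA _] := VA _ IV.
  split => //; first exact: (laminar_measurable lamC2).
  move=> y Iy; apply: (le_trans leA); rewrite lee_wpmul2l//.
  have mI1 := laminar_measurable lamC1 CI1.
  rewrite le_measure ?inE//.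
    by apply: measurableI => //; exact: measurable_ysection.
  move=> x Ax; split; first exact: sA.
  by apply/ysectionP; exists (A I, I.2) => //; apply/mapP; exists I.
have le2 : (m1 \x m2) (rect_cover V') <= 4%:E * (m1 \x m2) B.
  apply: (rect_cover_fibers2 m1 lamC2) => //.
  move=> Q /mapP[I IV ->] /=; have [CI1 CI2 _] := VB _ IV.
  by have [mA _ _ leB] := VA _ IV; split.
apply: (le_trans le1); rewrite (_ : 16%:E = 4%:E * 4%:E :> \bar R).
  by rewrite -muleA lee_wpmul2l.
by rewrite -EFinM; congr EFin; ring.
Qed.

End StrongCovering.

(** * Exponential integrability *)

Section WeightedProduct.
Context {I T : Type} {R : realType}.
Implicit Types (V : seq I) (K : I -> set T) (b : I -> R).

Definition wprod V K b (x : T) : R :=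
  \prod_(J <- V) (1 + b J * \1_(K J) x).

Lemma wprod_ge1 V K b x : (forall J, 0 <= b J) -> 1 <= wprod V K b x.
Proof.
move=> b0; rewrite /wprod; elim/big_rec: _ => // J p _ p1.
by rewrite -[leLHS]mulr1 ler_pM// lerDl mulr_ge0.
Qed.

End WeightedProduct.

Lemma wprod_rem {I : eqType} {T : Type} {R : realType} (V : seq I)
    (K : I -> set T) (b : I -> R) (J : I) (x : T) : J \in V ->
  wprod V K b x = (1 + b J * \1_(K J) x) * wprod (rem J V) K b x.
Proof. exact: big_rem. Qed.

Lemma measurable_wprod {I : eqType} {d} {T : measurableType d} {R : realType}
    (V : seq I) (K : I -> set T) (b : I -> R) :
  {in V, forall J, measurable (K J)} -> measurable_fun setT (wprod V K b).
Proof.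
elim: V => [|J V IHV] mK.
  rewrite (_ : wprod _ _ _ = cst 1); first exact: measurable_cst.
  by apply/funext => x; rewrite /wprod big_nil.
rewrite (_ : wprod _ _ _ =
    (cst 1 \+ (cst (b J) \* \1_(K J))) \* wprod V K b); last first.
  by apply/funext => x; rewrite /wprod big_cons.
apply: measurable_funM; last first.
  by apply: IHV => L LV; apply: mK; rewrite inE LV orbT.
apply: measurable_funD => //; apply: measurable_funM => //.
by apply: measurable_indic; apply: mK; exact: mem_head.
Qed.

Definition incomparable {T1 T2 : Type} (V : seq (set T1 * set T2)) : Prop :=
  {in V &, forall I J, I.1 `<=` J.1 -> I.2 `<=` J.2 -> I = J}.

Lemma integral_rect {d1 d2 : measure_display} {T1 : measurableType d1}
    {T2 : measurableType d2} {R : realType}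
    (m1 : {sigma_finite_measure set T1 -> \bar R})
    (m2 : {sigma_finite_measure set T2 -> \bar R})
    (A : set T1) (B : set T2) (u : T1 -> R) (v : T2 -> R) :
  measurable A -> measurable B ->
  measurable_fun setT u -> measurable_fun setT v ->
  (forall x, 0 <= u x) -> (forall y, 0 <= v y) ->
  (\int[m1 \x m2]_(x in A `*` B) (u x.1 * v x.2)%:E =
   \int[m1]_(x in A) (u x)%:E * \int[m2]_(y in B) (v y)%:E)%E.
Proof.
move=> mA mB mu mv u0 v0.
pose u' := (fun x => u x * \1_A x); pose v' := (fun y => v y * \1_B y).
have mu' : measurable_fun setT u'.
  by apply: measurable_funM => //; exact: measurable_indic.
have mv' : measurable_fun setT v'.
  by apply: measurable_funM => //; exact: measurable_indic.
have u'0 x : 0 <= u' x by rewrite mulr_ge0.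
have v'0 y : 0 <= v' y by rewrite mulr_ge0.
rewrite [LHS]integral_mkcond.
rewrite [X in (X * _)%E]integral_mkcond [X in (_ * X)%E]integral_mkcond.
rewrite (_ : _ \_ (A `*` B) = fun x => (u' x.1 * v' x.2)%:E); last first.
  apply/funext => -[x y]; rewrite patchE in_setX /u' /v' /= !indicE.
  by do 2!case: (_ \in _); rewrite /= ?mulr1 ?mulr0 ?mul0r.
rewrite (_ : _ \_ A = fun x => (u' x)%:E); last first.
  apply/funext => x; rewrite patchE /u' indicE.
  by case: (_ \in _); rewrite /= ?mulr1 ?mulr0.
rewrite (_ : _ \_ B = fun y => (v' y)%:E); last first.
  apply/funext => y; rewrite patchE /v' indicE.
  by case: (_ \in _); rewrite /= ?mulr1 ?mulr0.
rewrite fubini_tonelli1//; first last.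
- by move=> x; rewrite lee_fin mulr_ge0.
- apply/measurable_EFinP; apply: measurable_funM.
    exact: (measurableT_comp mu').
  exact: (measurableT_comp mv').
have ? : (0 <= \int[m2]_y (v' y)%:E)%E.
  by apply: integral_ge0 => y _; rewrite lee_fin.
rewrite -ge0_integralZr//; [|exact/measurable_EFinP|by move=> x _; rewrite lee_fin].
apply: eq_integral => x _; rewrite /fubini_F.
rewrite -[RHS]ge0_integralZl//; first exact/measurable_EFinP.
  by move=> y _; rewrite lee_fin.
by rewrite lee_fin.
Qed.

(** From 7/5 m(A) < int u <= int (g - 1) + m(A), the excess is more than 2/5 m(A). If the integral
    of g - 1 is infinite, the bound is trivial. *)
Lemma measure_le_excess {d} {T : measurableType d} {R : realType}
    (m : {measure set T -> \bar R}) (A : set T) (u g : T -> R) :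
  measurable A -> (m A < +oo)%E -> measurable_fun setT u ->
  measurable_fun setT g -> (forall x, A x -> 1 <= u x <= g x) ->
  ((7 / 5)%:E * m A < \int[m]_(x in A) (u x)%:E)%E ->
  (m A <= (5 / 2)%:E * \int[m]_(x in A) (g x - 1)%:E)%E.
Proof.
move=> mA fA mu mg ug lt_u.
have fmA : m A \is a fin_num by rewrite ge0_fin_numE.
have g1 x : A x -> (0 <= (g x - 1)%:E)%E.
  by move=> /ug/andP[u1 le]; rewrite lee_fin subr_ge0 (le_trans u1).
have : ((7 / 5)%:E * m A < \int[m]_(x in A) (g x - 1)%:E + m A)%E.
  apply: (lt_le_trans lt_u); rewrite -[m A]mul1e -(integral_cst m mA).
  rewrite -ge0_integralD//; last first.
    apply/measurable_EFinP; apply: measurable_funTS.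
    by apply: measurable_funB => //.
  apply: ge0_le_integral => //.
  - by move=> x /ug/andP[u1 _]; rewrite lee_fin (le_trans ler01).
  - by apply/measurable_EFinP; exact: measurable_funTS.
  - apply: emeasurable_funD => //; apply/measurable_EFinP; apply: measurable_funTS.
    by apply: measurable_funB.
  by move=> x /ug/andP[_ le]; rewrite /= -EFinD lee_fin subrK.
have : (0 <= \int[m]_(x in A) (g x - 1)%:E)%E by exact: integral_ge0.
rewrite -(fineK fmA); case: (integral _ _ _) => [r||]//=.
- by rewrite -EFinM -EFinD !lee_fin lte_fin => *; lra.
- by move=> *; rewrite gt0_muley ?leey// lte_fin.
Qed.

Section LightRectangle.
Context {d1 d2 : measure_display} {T1 : measurableType d1}
  {T2 : measurableType d2} {R : realType}.
Variables (m1 : {sigma_finite_measure set T1 -> \bar R})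
  (m2 : {sigma_finite_measure set T2 -> \bar R}).
Variables (C1 : set (set T1)) (C2 : set (set T2)).
Hypotheses (lamC1 : laminar m1 C1) (lamC2 : laminar m2 C2).
Variable b : set T1 * set T2 -> R.
Hypothesis b0 : forall J, 0 <= b J.
Local Notation rect := (set T1 * set T2)%type.
Local Notation rs J := (J.1 `*` J.2).
Local Notation P V := (wprod V (fun J => J.1 `*` J.2) b).
Implicit Types V : seq rect.

(** On I, a member J that crosses I in the second variable and is shorter in the first has the
    indicator of J.1. In all other cases the empty set contributes the neutral factor 1; [thin] is
    the mirror image. *)
Let short (I J : rect) : set T1 :=
  if `[< J.1 `<=` I.1 /\ I.2 `<=` J.2 >] then J.1 else set0.
Let thin (I J : rect) : set T2 :=
  if `[< I.1 `<=` J.1 /\ J.2 `<=` I.2 >] then J.2 else set0.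

(* On a member I of an incomparable family, each other member that meets I
   depends on one variable only. *)
Lemma wprod_factor V I x : uniq V -> incomparable V ->
  {in V, forall J, C1 J.1 /\ C2 J.2} -> I \in V -> rs I x ->
  P V x = (1 + b I) *
    (wprod (rem I V) (short I) b x.1 * wprod (rem I V) (thin I) b x.2).
Proof.
move=> uV incV CV IV [Ix1 Ix2]; rewrite (wprod_rem _ _ _ IV).
rewrite indicE mem_set// mulr1 /wprod -big_split /=; congr (_ * _).
rewrite big_seq [RHS]big_seq; apply: eq_bigr => J.
rewrite (mem_rem_uniq _ uV) inE => /andP[/eqP JI JV].
have [[CI1 CI2] [CJ1 CJ2]] := (CV _ IV, CV _ JV).
rewrite /short /thin; case: asboolP => [[J1 I2]|nJI].
  case: asboolP => [[I1 J2]|_]; first by case: JI; exact: incV.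
  rewrite indic0 mulr0 addr0 mulr1 !indicE; congr (1 + _ * (_ : bool)%:R).
  by rewrite in_setX [x.2 \in J.2]mem_set ?andbT//; exact: I2.
case: asboolP => [[I1 J2]|nIJ].
  rewrite indic0 mulr0 addr0 mul1r !indicE; congr (1 + _ * (_ : bool)%:R).
  by rewrite in_setX [x.1 \in J.1]mem_set//; exact: I1.
(* A remaining J cannot contain x: both pairs of sides would be nested, in the same direction
   against incomparability, or in opposite directions, which makes J short or thin. *)
rewrite !indic0 !mulr0 !addr0 mulr1 indicE memNset ?mulr0 ?addr0// => -[Jx1 Jx2].
have [JI1|IJ1|/seteqP[IJ1 _]] := laminar_nested lamC1 CJ1 CI1;
  last exact: (IJ1 x.1).
- have [JI2|IJ2|/seteqP[IJ2 _]] := laminar_nested lamC2 CJ2 CI2.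
  + by apply: JI; exact: incV.
  + exact: nJI.
  + exact: (IJ2 x.2).
- have [JI2|IJ2|/seteqP[IJ2 _]] := laminar_nested lamC2 CJ2 CI2.
  + exact: nIJ.
  + by apply: JI; apply/esym; exact: incV.
  + exact: (IJ2 x.2).
Qed.

Let mshort V I : {in V, forall J, C1 J.1 /\ C2 J.2} ->
  {in rem I V, forall J, measurable (short I J)}.
Proof.
move=> CV J /mem_rem JV; rewrite /short; case: asboolP => // _.
by apply: (laminar_measurable lamC1); exact: (CV _ JV).1.
Qed.

Let mthin V I : {in V, forall J, C1 J.1 /\ C2 J.2} ->
  {in rem I V, forall J, measurable (thin I J)}.
Proof.
move=> CV J /mem_rem JV; rewrite /thin; case: asboolP => // _.
by apply: (laminar_measurable lamC2); exact: (CV _ JV).2.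
Qed.

Lemma measurable_rs V : {in V, forall J, C1 J.1 /\ C2 J.2} ->
  {in V, forall J, measurable (rs J)}.
Proof.
move=> CV J /CV[CJ1 CJ2]; apply: measurableX.
- exact: (laminar_measurable lamC1).
- exact: (laminar_measurable lamC2).
Qed.

(* The threshold 7/5 satisfies (1 + 1/256) (7/5)^2 <= 2 and 1/(7/5 - 1) = 5/2. *)
Lemma heavy_or_light V I : uniq V -> incomparable V ->
  {in V, forall J, C1 J.1 /\ C2 J.2} -> I \in V -> b I <= 256^-1 ->
  [\/ forall y, I.2 y ->
        (m1 I.1 <= (5 / 2)%:E * \int[m1]_(x in I.1) (P V (x, y) - 1)%:E)%E,
      forall x, I.1 x ->
        (m2 I.2 <= (5 / 2)%:E * \int[m2]_(y in I.2) (P V (x, y) - 1)%:E)%E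
    | (\int[m1 \x m2]_(x in rs I) (P V x)%:E <= 2%:E * (m1 \x m2) (rs I))%E].
Proof.
move=> uV incV CV IV bI; have [CI1 CI2] := CV _ IV.
have mI1 := laminar_measurable lamC1 CI1.
have mI2 := laminar_measurable lamC2 CI2.
have fI1 : m1 I.1 \is a fin_num.
  by rewrite ge0_fin_numE// (laminar_fin lamC1 CI1).
have fI2 : m2 I.2 \is a fin_num.
  by rewrite ge0_fin_numE// (laminar_fin lamC2 CI2).
have mP : measurable_fun setT (P V) by apply: measurable_wprod; exact: measurable_rs.
pose u := wprod (rem I V) (short I) b; pose v := wprod (rem I V) (thin I) b.
have mu : measurable_fun setT u by apply: measurable_wprod; exact: mshort.
have mv : measurable_fun setT v by apply: measurable_wprod; exact: mthin.
have u1 x : 1 <= u x by exact: wprod_ge1.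
have v1 x : 1 <= v x by exact: wprod_ge1.
have mP1 y : measurable_fun setT (fun x => P V (x, y)).
  exact: (measurable_fun_pair1 (f := P V)).
have mP2 x : measurable_fun setT (fun y => P V (x, y)).
  exact: (measurable_fun_pair2 (f := P V)).
have uP x y : I.1 x -> I.2 y -> 1 <= u x <= P V (x, y).
  move=> Ix Iy; rewrite u1/= (wprod_factor uV incV CV IV)//= mulrCA ler_peMr//.
    by rewrite (le_trans ler01).
  by rewrite -[leLHS]mulr1 ler_pM// lerDl.
have vP x y : I.1 x -> I.2 y -> 1 <= v y <= P V (x, y).
  move=> Ix Iy; rewrite v1/= (wprod_factor uV incV CV IV)//= mulrA ler_peMl//.
    by rewrite (le_trans ler01).
  by rewrite -[leLHS]mulr1 ler_pM// lerDl.
have [ule|ugt] := leP (\int[m1]_(x in I.1) (u x)%:E)%E ((7 / 5)%:E * m1 I.1)%E;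
  last first.
  (* The average of u does not involve y, so the excess is large on every horizontal fibre of I, as
     [rect_cover_le1] requires. *)
  apply: Or31 => y Iy; apply: measure_le_excess ugt => //.
    exact: (laminar_fin lamC1).
  by move=> x Ix; exact: uP.
have [vle|vgt] := leP (\int[m2]_(y in I.2) (v y)%:E)%E ((7 / 5)%:E * m2 I.2)%E;
  last first.
  apply: Or32 => x Ix; apply: measure_le_excess vgt => //.
    exact: (laminar_fin lamC2).
  by move=> y Iy; exact: vP.
apply: Or33.
rewrite (eq_integral (fun x => ((1 + b I) * u x.1 * v x.2)%:E)); last first.
  by move=> x /set_mem Ix; rewrite (wprod_factor uV incV CV IV)// mulrA.
rewrite (@integral_rect _ _ _ _ _ m1 m2 I.1 I.2 (fun x => (1 + b I) * u x) v)//;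
  first last.
- by move=> y; rewrite (le_trans ler01).
- by move=> x; rewrite mulr_ge0 ?addr_ge0// (le_trans ler01).
- exact: measurable_funM.
under eq_integral do rewrite EFinM.
rewrite ge0_integralZl//; first last.
- by rewrite lee_fin addr_ge0.
- by move=> x _; rewrite lee_fin (le_trans ler01).
- by apply/measurable_EFinP; exact: measurable_funTS.
have -> : (m1 \x m2)%E (rs I) = (m1 I.1 * m2 I.2)%E.
  exact: product_measure1E.
have pu : (0 <= \int[m1]_(x in I.1) (u x)%:E)%E.
  by apply: integral_ge0 => x _; rewrite lee_fin (le_trans ler01).
have pv : (0 <= \int[m2]_(x in I.2) (v x)%:E)%E.
  by apply: integral_ge0 => x _; rewrite lee_fin (le_trans ler01).
apply: (@le_trans _ _ ((257 / 256)%:E * ((7 / 5)%:E * m1 I.1) *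
    ((7 / 5)%:E * m2 I.2))%E).
  apply: lee_pmul => //.
    by rewrite mule_ge0// lee_fin addr_ge0.
  by apply: lee_pmul => //; rewrite lee_fin ?addr_ge0//; lra.
rewrite -(fineK fI1) -(fineK fI2) -!EFinM lee_fin.
have p1 : 0 <= fine (m1 I.1) by rewrite fine_ge0.
have p2 : 0 <= fine (m2 I.2) by rewrite fine_ge0.
have := mulr_ge0 p1 p2; set X := fine _; set Y := fine _ => XY.
have -> : 257 / 256 * (7 / 5 * X) * (7 / 5 * Y) = 12593 / 6400 * (X * Y) by field.
by apply: ler_wpM2r => //; lra.
Qed.

Lemma rect_cover_fin V : {in V, forall J, C1 J.1 /\ C2 J.2} ->
  ((m1 \x m2) (rect_cover V) < +oo)%E.
Proof.
move=> CV; have mV := measurable_rs CV; rewrite rect_coverE.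
apply: (@le_lt_trans _ _ (\sum_(J <- V) (m1 \x m2) (rs J))%E).
  elim: V mV {CV} => [|J V IHV] mV; first by rewrite !big_nil measure0.
  have mV' : {in V, forall L, measurable (rs L)}.
    by move=> L LV; apply: mV; rewrite inE LV orbT.
  rewrite !big_cons; apply: le_trans (leeD (lexx _) (IHV mV')).
  apply: measureU2; first by apply: mV; exact: mem_head.
  by rewrite big_seq; apply: bigsetU_measurable.
rewrite big_seq; apply: lte_sum_pinfty => J /CV[CJ1 CJ2].
rewrite [ltLHS](product_measure1E m1 m2).
- apply: lte_mul_pinfty => //; last exact: (laminar_fin lamC2).
  by rewrite ge0_fin_numE// (laminar_fin lamC1).
- exact: (laminar_measurable lamC1).
- exact: (laminar_measurable lamC2).
Qed.

(** Otherwise the members heavy in the first variable and those heavy in the second exhaust V, and X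
    = |sh V| satisfies X <= 5 int (P - 1) <= X / 2, absurd for 0 < X < oo. Any constant below 1/5
    would serve in place of 1/10. *)
Lemma exists_light V : V != [::] -> uniq V -> incomparable V ->
  {in V, forall J, [/\ C1 J.1, C2 J.2 & b J <= 256^-1]} ->
  (\int[m1 \x m2]_x (P V x - 1)%:E <= 10^-1%:E * (m1 \x m2) (rect_cover V))%E ->
  exists2 I, I \in V &
    (\int[m1 \x m2]_(x in rs I) (P V x)%:E <= 2%:E * (m1 \x m2) (rs I))%E.
Proof.
have absurd (X S : R) :
    0 < X -> X <= 5 / 2 * S + 5 / 2 * S -> S <= 10^-1 * X -> False.
  by move=> *; lra.
move=> V0 uV incV VC leS.
have CV : {in V, forall J, C1 J.1 /\ C2 J.2} by move=> J /VC[].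
have mV : {in V, forall J, measurable J.1 /\ measurable J.2}.
  move=> J /CV[? ?]; split; first exact: (laminar_measurable lamC1).
  exact: (laminar_measurable lamC2).
apply/not_exists2P => noI.
pose h1 I := forall y, I.2 y ->
  (m1 I.1 <= (5 / 2)%:E * \int[m1]_(x in I.1) (P V (x, y) - 1)%:E)%E.
pose h2 I := forall x, I.1 x ->
  (m2 I.2 <= (5 / 2)%:E * \int[m2]_(y in I.2) (P V (x, y) - 1)%:E)%E.
pose V1 := [seq J <- V | `[< h1 J >]]; pose V2 := [seq J <- V | `[< h2 J >]].
have sV1 J : J \in V1 -> J \in V by rewrite mem_filter => /andP[].
have sV2 J : J \in V2 -> J \in V by rewrite mem_filter => /andP[].
have VE : rect_cover V `<=` rect_cover V1 `|` rect_cover V2.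
  move=> x [I IV Ix]; have [_ _ bI] := VC _ IV.
  have [h|h|h] := heavy_or_light uV incV CV IV bI.
  - by left; exists I => //; rewrite mem_filter IV andbT; apply/asboolP.
  - by right; exists I => //; rewrite mem_filter IV andbT; apply/asboolP.
  - by case: (noI I).
have mF : measurable_fun setT (fun x => (P V x - 1)%:E).
  apply/measurable_EFinP; apply: measurable_funB => //.
  by apply: measurable_wprod; exact: measurable_rs.
have F0 x : (0 <= (P V x - 1)%:E)%E by rewrite lee_fin subr_ge0 wprod_ge1.
have le1 : ((m1 \x m2) (rect_cover V1) <=
    (5 / 2)%:E * \int[m1 \x m2]_x (P V x - 1)%:E)%E.
  apply: (rect_cover_le1 m2 lamC1) => // J JV1; have JV := sV1 _ JV1.
  split; [exact: (CV _ JV).1|exact: (mV _ JV).2|].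
  by move: JV1; rewrite mem_filter => /andP[/asboolP].
have le2 : ((m1 \x m2) (rect_cover V2) <=
    (5 / 2)%:E * \int[m1 \x m2]_x (P V x - 1)%:E)%E.
  apply: (rect_cover_le2 m1 lamC2) => // J JV2; have JV := sV2 _ JV2.
  split; [exact: (mV _ JV).1|exact: (CV _ JV).2|].
  by move: JV2; rewrite mem_filter => /andP[/asboolP].
have mc W : {subset W <= V} -> measurable (rect_cover W).
  by move=> WV; apply: measurable_rect_cover => J /WV; exact: mV.
have leV : ((m1 \x m2) (rect_cover V) <=
    (5 / 2)%:E * \int[m1 \x m2]_x (P V x - 1)%:E +
    (5 / 2)%:E * \int[m1 \x m2]_x (P V x - 1)%:E)%E.
  apply: le_trans (leeD le1 le2).
  have mc1 := mc _ sV1; have mc2 := mc _ sV2.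
  apply: (@le_trans _ _ ((m1 \x m2)%E (rect_cover V1 `|` rect_cover V2))).
    rewrite le_measure ?inE//; first exact: mc.
    exact: measurableU.
  exact: measureU2.
have [V0I IV] : exists J, J \in V.
  by case: (V) V0 => // J W _; exists J; exact: mem_head.
have [CI1 CI2] := CV _ IV.
have gt0 : (0 < (m1 \x m2) (rect_cover V))%E.
  apply: (@lt_le_trans _ _ (m1 V0I.1 * m2 V0I.2)%E).
    by rewrite mule_gt0// ?(laminar_gt0 lamC1)// (laminar_gt0 lamC2).
  rewrite -[leLHS](product_measure1E m1 m2); [|exact: (mV _ IV).1|exact: (mV _ IV).2].
  rewrite le_measure ?inE//; [|exact: mc|by move=> x Ix; exists V0I].
  by apply: measurableX; [exact: (mV _ IV).1|exact: (mV _ IV).2].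
have fV := rect_cover_fin CV.
have fmV : (m1 \x m2)%E (rect_cover V) \is a fin_num by rewrite ge0_fin_numE.
have fS : (\int[m1 \x m2]_x (P V x - 1)%:E)%E \is a fin_num.
  rewrite ge0_fin_numE ?integral_ge0//; apply: (le_lt_trans leS).
  by rewrite -(fineK fmV) -EFinM ltry.
move: gt0 leV leS; rewrite -(fineK fmV) -(fineK fS) -!EFinM -EFinD.
by rewrite lte_fin !lee_fin; exact: absurd.
Qed.

End LightRectangle.

Section ExponentialBound.
Context {d1 d2 : measure_display} {T1 : measurableType d1}
  {T2 : measurableType d2} {R : realType}.
Variables (m1 : {sigma_finite_measure set T1 -> \bar R})
  (m2 : {sigma_finite_measure set T2 -> \bar R}).
Variables (C1 : set (set T1)) (C2 : set (set T2)).
Hypotheses (lamC1 : laminar m1 C1) (lamC2 : laminar m2 C2).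
Variable b : set T1 * set T2 -> R.
Hypothesis b0 : forall J, 0 <= b J.
Local Notation rs J := (J.1 `*` J.2).
Local Notation P V := (wprod V (fun J => J.1 `*` J.2) b).
Implicit Types V : seq (set T1 * set T2).

Let mPB1 V : {in V, forall J, C1 J.1 /\ C2 J.2} ->
  measurable_fun setT (fun x => (P V x - 1)%:E).
Proof.
move=> CV; apply/measurable_EFinP; apply: measurable_funB => //.
by apply: measurable_wprod; exact: (measurable_rs lamC1 lamC2).
Qed.

Let PB1_ge0 V x : (0 <= (P V x - 1)%:E)%E.
Proof. by rewrite lee_fin subr_ge0 wprod_ge1. Qed.

(** With p the product without J, P - 1 = (1 + b_J 1_J)(p - 1) + b_J 1_J. The factor 257/256 would
    accumulate over many removals; the bound serves only once per induction step, to supply the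
    smallness for [exists_light]. *)
Lemma wprod_integral_rem_le V J : {in V, forall L, C1 L.1 /\ C2 L.2} ->
  J \in V -> b J <= 256^-1 ->
  (\int[m1 \x m2]_x (P V x - 1)%:E <=
    (257 / 256)%:E * \int[m1 \x m2]_x (P (rem J V) x - 1)%:E +
    (b J)%:E * (m1 \x m2) (rs J))%E.
Proof.
move=> CV JV bJ.
have mJ := measurable_rs lamC1 lamC2 CV JV.
have CV' : {in rem J V, forall L, C1 L.1 /\ C2 L.2}.
  by move=> L /mem_rem; exact: CV.
rewrite -[in X in (_ <= _ + _ * X)%E](setIT (rs J)) -integral_indic//.
have mi : measurable_fun setT (fun x => (\1_(rs J) x)%:E : \bar R).
  by apply/measurable_EFinP; exact: measurable_indic.
rewrite -ge0_integralZl//; last exact: mPB1.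
rewrite -[in X in (_ <= _ + X)%E]ge0_integralZl ?lee_fin//.
rewrite -ge0_integralD//; first last.
- by apply: measurable_funeM; exact: mi.
- by move=> x _; rewrite mule_ge0 ?lee_fin.
- by apply: measurable_funeM; exact: mPB1.
- by move=> x _; apply: mule_ge0; [rewrite lee_fin; lra|exact: PB1_ge0].
apply: ge0_le_integral => //.
- exact: mPB1.
- apply: emeasurable_funD; apply: measurable_funeM; last exact: mi.
  exact: mPB1.
move=> x _; rewrite (wprod_rem _ _ _ JV) -!EFinM -EFinD lee_fin.
have := wprod_ge1 (rem J V) (fun J => rs J) x b0; set p := wprod _ _ _ _.
have := b0 J; rewrite indicE; case: (_ \in _) => /= bJ0 p1.
- by rewrite !mulr1; nra.
- by rewrite !mulr0; nra.
Qed.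

(** Here P - 1 <= (p - 1) + b_J 1_J P, with coefficient 1 on the old integral, so that successive
    removals telescope. *)
Lemma wprod_integral_light V J : {in V, forall L, C1 L.1 /\ C2 L.2} ->
  J \in V ->
  (\int[m1 \x m2]_(x in rs J) (P V x)%:E <= 2%:E * (m1 \x m2) (rs J))%E ->
  (\int[m1 \x m2]_x (P V x - 1)%:E <=
    \int[m1 \x m2]_x (P (rem J V) x - 1)%:E +
    2%:E * ((b J)%:E * (m1 \x m2) (rs J)))%E.
Proof.
move=> CV JV light.
have mJ := measurable_rs lamC1 lamC2 CV JV.
have CV' : {in rem J V, forall L, C1 L.1 /\ C2 L.2}.
  by move=> L /mem_rem; exact: CV.
have mP : measurable_fun setT (P V).
  by apply: measurable_wprod; exact: (measurable_rs lamC1 lamC2).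
have P0 x : 0 <= P V x by rewrite (le_trans ler01)// wprod_ge1.
apply: (@le_trans _ _ (\int[m1 \x m2]_x (P (rem J V) x - 1)%:E +
    (b J)%:E * \int[m1 \x m2]_(x in rs J) (P V x)%:E)%E); last first.
  by apply: leeD => //; rewrite muleCA lee_wpmul2l ?lee_fin.
have mi : measurable_fun setT (fun x => (P V x * \1_(rs J) x)%:E).
  by apply/measurable_EFinP; apply: measurable_funM => //; exact: measurable_indic.
rewrite [X in (_ <= _ + _ * X)%E]integral_mkcond.
rewrite (_ : _ \_ _ = fun x => (P V x * \1_(rs J) x)%:E); last first.
  apply/funext => x; rewrite patchE indicE.
  by case: (_ \in _); rewrite /= ?mulr1 ?mulr0.
rewrite -ge0_integralZl ?lee_fin//; [|by move=> x _; rewrite lee_fin mulr_ge0].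
rewrite -ge0_integralD//; first last.
- by apply: measurable_funeM; exact: mi.
- by move=> x _; apply: mule_ge0; rewrite lee_fin ?mulr_ge0.
- exact: mPB1.
apply: ge0_le_integral => //.
- exact: mPB1.
- by apply: emeasurable_funD; [exact: mPB1|apply: measurable_funeM; exact: mi].
move=> x _; rewrite (wprod_rem _ _ _ JV) -!EFinM -EFinD lee_fin.
have := wprod_ge1 (rem J V) (fun J => rs J) x b0; set p := wprod _ _ _ _.
have := b0 J; rewrite indicE; case: (_ \in _) => /= bJ0 p1.
- by rewrite !mulr1; nra.
- by rewrite !mulr0; nra.
Qed.

(** The induction hypothesis is used twice: for V without an arbitrary J, to see that the integral
    is small and a light I exists, and then for V without this I. The Carleson hypothesis ranges
    over all subfamilies so that it passes to both. *)
Lemma exp_bound V : uniq V -> incomparable V ->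
  {in V, forall J, [/\ C1 J.1, C2 J.2 & b J <= 256^-1]} ->
  (forall W, uniq W -> {subset W <= V} ->
    (\sum_(J <- W) (b J)%:E * (m1 \x m2) (rs J) <=
      32^-1%:E * (m1 \x m2) (rect_cover W))%E) ->
  (\int[m1 \x m2]_x (P V x - 1)%:E <=
    2%:E * \sum_(J <- V) (b J)%:E * (m1 \x m2) (rs J))%E.
Proof.
have [n] := ubnP (size V); elim: n V => // n IHn V sV uV incV VC carl.
have CV : {in V, forall J, C1 J.1 /\ C2 J.2} by move=> J /VC[].
have [V0|[J JV]] : V = [::] \/ exists J, J \in V.
  case: (V) => [|J W]; first by left.
  by right; exists J; exact: mem_head.
  rewrite V0 big_nil mule0 (eq_integral (cst 0%E)) ?integral0//.
  by move=> x _; rewrite /wprod big_nil subrr.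
have IH L : L \in V -> (\int[m1 \x m2]_x (P (rem L V) x - 1)%:E <=
    2%:E * \sum_(J <- rem L V) (b J)%:E * (m1 \x m2) (rs J))%E.
  move=> LV; have rV : {subset rem L V <= V} by move=> ?; exact: mem_rem.
  apply: IHn.
  - by rewrite size_rem// -ltnS prednK//; case: (V) LV.
  - exact: rem_uniq.
  - by move=> A B /rV AV /rV BV; exact: incV.
  - by move=> A /rV; exact: VC.
  - by move=> W uW WV; apply: carl => // A /WV/rV.
have V0 : V != [::] by apply: contraTneq JV => ->.
have [|I IV light] := @exists_light _ _ _ _ _ m1 m2 C1 C2 lamC1 lamC2 b b0 V V0 uV incV VC.
  have [CJ1 CJ2 bJ] := VC _ JV.
  apply: (le_trans (wprod_integral_rem_le CV JV bJ)).
  have mc W : {subset W <= V} -> measurable (rect_cover W).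
    move=> WV; apply: measurable_rect_cover => L /WV/CV[? ?]; split.
      exact: (laminar_measurable lamC1).
    exact: (laminar_measurable lamC2).
  have rV : {subset rem J V <= V} by move=> ?; exact: mem_rem.
  have le1 : ((m1 \x m2) (rs J) <= (m1 \x m2) (rect_cover V))%E.
    rewrite le_measure ?inE//; first exact: (measurable_rs lamC1 lamC2 CV).
      exact: mc.
    by move=> x Jx; exists J.
  have le2 : (\int[m1 \x m2]_x (P (rem J V) x - 1)%:E <=
      16^-1%:E * (m1 \x m2) (rect_cover V))%E.
    apply: (le_trans (IH J JV)).
    have -> : (16^-1 = 2 * 32^-1 :> R)%R by field.
    rewrite EFinM -muleA; apply: lee_wpmul2l => //.
    apply: (le_trans (carl _ (rem_uniq _ uV) rV)); apply: lee_wpmul2l => //.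
    by rewrite le_measure ?inE//; [exact: mc|exact: mc|
      move=> x [L /rV LV Lx]; exists L].
  (* The total constant is 257/4096 + 1/256 = 273/4096, less than 1/10. *)
  apply: (@le_trans _ _ ((257 / 256)%:E * (16^-1%:E * (m1 \x m2) (rect_cover V)) +
      256^-1%:E * (m1 \x m2) (rect_cover V))%E).
    apply: leeD; first by apply: lee_wpmul2l => //; rewrite lee_fin; lra.
    by apply: lee_pmul => //; rewrite ?lee_fin.
  rewrite muleA -EFinM -ge0_muleDl ?lee_fin//.
  by rewrite -EFinD; apply: lee_wpmul2r => //; rewrite lee_fin; lra.
apply: (le_trans (wprod_integral_light CV IV light)).
rewrite (_ : bigop.body _ _ _ = ((b I)%:E * (m1 \x m2) (rs I) +
  \sum_(J <- rem I V) (b J)%:E * (m1 \x m2) (rs J))%E); last exact: big_rem.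
set x := ((b I)%:E * _)%E; set y := (\sum_(_ <- _) _)%E.
have x0 : (0 <= x)%E by rewrite /x mule_ge0 ?lee_fin.
have y0 : (0 <= y)%E by apply: sume_ge0 => L _; rewrite mule_ge0 ?lee_fin.
by rewrite ge0_muleDr// addeC; apply: leeD => //; exact: IH.
Qed.

End ExponentialBound.

(** * Carleson conditions and sparse selection *)

Section Selection.
Context {d1 d2 : measure_display} {T1 : measurableType d1}
  {T2 : measurableType d2} {R : realType}.
Variables (m1 : {sigma_finite_measure set T1 -> \bar R})
  (m2 : {sigma_finite_measure set T2 -> \bar R}).
Variables (C1 : set (set T1)) (C2 : set (set T2)).
Hypotheses (lamC1 : laminar m1 C1) (lamC2 : laminar m2 C2).
Local Notation rs J := (J.1 `*` J.2).
Implicit Types V : seq (set T1 * set T2).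
Local Open Scope ereal_scope.

(** Each J has at most 4 = 2 * 2 times the measure of A J times B J, and the weighted overlap of
    these products is at most N and vanishes off the cover. *)
Lemma bounded_overlap_carleson V (W : set T1 * set T2 -> R)
    (A : set T1 * set T2 -> set T1) (B : set T1 * set T2 -> set T2) (N : R) :
  {in V, forall J, C1 J.1 /\ C2 J.2} -> (forall J, (0 <= W J)%R) ->
  {in V, forall J, [/\ measurable (A J), A J `<=` J.1 &
    m1 J.1 <= 2%:E * m1 (A J)]} ->
  {in V, forall J, [/\ measurable (B J), B J `<=` J.2 &
    m2 J.2 <= 2%:E * m2 (B J)]} ->
  (forall x, (\sum_(J <- V) W J * \1_(A J `*` B J) x <= N)%R) ->
  \sum_(J <- V) (W J)%:E * (m1 \x m2) (rs J) <=
    (4 * N)%:E * (m1 \x m2) (rect_cover V).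
Proof.
move=> CV W0 VA VB leN.
have mV : measurable (rect_cover V).
  apply: measurable_rect_cover => J /CV[? ?]; split.
    exact: (laminar_measurable lamC1).
  exact: (laminar_measurable lamC2).
have mAB J : J \in V -> measurable (A J `*` B J).
  by move=> JV; have [? _ _] := VA _ JV; have [? _ _] := VB _ JV; exact: measurableX.
have N0 : (0 <= N)%R.
  have [V0|[J JV]] : V = [::] \/ exists J, J \in V.
    case: (V) => [|J W']; first by left.
    by right; exists J; exact: mem_head.
    by have := leN (point, point); rewrite V0 big_nil.
  apply: le_trans (leN (point, point)).
  by apply: sumr_ge0 => L _; rewrite mulr_ge0.
(* The hypotheses say nothing about A J and B J for J outside V; the default makes every [D J]
   measurable. *)
pose D J := if J \in V then A J `*` B J else set0.
have mD J : measurable (D J) by rewrite /D; case: ifP => // /mAB.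
apply: (@le_trans _ _ (4%:E * \sum_(J <- V)
    \int[m1 \x m2]_x (W J * \1_(D J) x)%:E)).
  rewrite ge0_sume_distrr; last first.
    by move=> J _; apply: integral_ge0 => x _; rewrite lee_fin mulr_ge0.
  rewrite big_seq [leRHS]big_seq; apply: lee_sum => J JV.
  have [mA sA leA] := VA _ JV; have [mB sB leB] := VB _ JV.
  under eq_integral do rewrite EFinM.
  rewrite ge0_integralZl ?lee_fin//; last first.
    by apply/measurable_EFinP; exact: measurable_indic.
  have -> : \int[m1 \x m2]_x (\1_(D J) x)%:E = (m1 \x m2) (D J).
    by rewrite integral_indic// setIT.
  rewrite muleCA; apply: lee_wpmul2l.
    by rewrite lee_fin.
  have -> : (m1 \x m2) (rs J) = m1 J.1 * m2 J.2.
    apply: product_measure1E; first exact: (laminar_measurable lamC1 (CV _ JV).1).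
    exact: (laminar_measurable lamC2 (CV _ JV).2).
  have -> : (m1 \x m2) (D J) = m1 (A J) * m2 (B J).
    by rewrite /D JV; exact: product_measure1E.
  apply: (@le_trans _ _ (2%:E * m1 (A J) * (2%:E * m2 (B J)))).
    exact: lee_pmul.
  rewrite (_ : 4%:E = 2%:E * 2%:E :> \bar R); last first.
    by rewrite -EFinM; congr EFin; ring.
  by rewrite !muleA [2%:E * m1 _ * _]muleAC.
rewrite EFinM -muleA; apply: lee_wpmul2l => //.
have mWD J : measurable_fun setT (fun x => (W J * \1_(D J) x)%:E).
  by apply/measurable_EFinP; apply: measurable_funM => //; exact: measurable_indic.
rewrite -ge0_integral_sum//; last first.
  by move=> J x _; rewrite lee_fin mulr_ge0.
have mcV : measurable_fun setT (fun x => (\1_(rect_cover V) x)%:E : \bar R).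
  by apply/measurable_EFinP; exact: measurable_indic.
rewrite -[in leRHS](setIT (rect_cover V)) -integral_indic// -ge0_integralZl ?lee_fin//.
apply: ge0_le_integral => //.
- by move=> x _; apply: sume_ge0 => J _; rewrite lee_fin mulr_ge0.
- exact: emeasurable_sum.
- by apply: measurable_funeM; exact: mcV.
move=> x _; rewrite sumEFin -EFinM lee_fin.
rewrite big_seq (eq_bigr (fun J => (W J * \1_(A J `*` B J) x)%R)); last first.
  by move=> J JV; rewrite /D JV.
rewrite -big_seq; have [Vx|nVx] := pselect (rect_cover V x).
  by rewrite indicE mem_set// mulr1.
rewrite big_seq big1 ?mulr_ge0// => J JV.
rewrite indicE memNset ?mulr0// => -[Ax Bx]; apply: nVx; exists J => //.
by have [_ sA _] := VA _ JV; have [_ sB _] := VB _ JV; split; [exact: sA|exact: sB].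
Qed.

(** Greedy choice from the end of the list: J is kept when at least 1/8 of it is not yet covered,
    and this part becomes [E J]. A rejected J is covered by more than 7/8; the weaker 1/2 is the
    form that [strong_cover] takes. *)
Lemma sparse_selection V : uniq V -> {in V, forall J, C1 J.1 /\ C2 J.2} ->
  exists (G : seq (set T1 * set T2)) (E : set T1 * set T2 -> set (T1 * T2)),
  [/\ {subset G <= V} /\ uniq G, trivIset [set` G] E,
    {in G, forall J, [/\ measurable (E J), E J `<=` rs J &
      8^-1%:E * (m1 \x m2) (rs J) <= (m1 \x m2) (E J)]} &
    {in V, forall J, (m1 \x m2) (rs J) <=
      2%:E * (m1 \x m2) (rs J `&` rect_cover G)}].
Proof.
elim: V => [|J V IHV] /=.
  by exists [::], (fun=> set0); split => // ? ?.
move=> /andP[JV uV] CV.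
have CV' : {in V, forall L, C1 L.1 /\ C2 L.2}.
  by move=> L LV; apply: CV; rewrite inE LV orbT.
have [G [E [[GV uG] tE GE VG]]] := IHV uV CV'.
have mJ := measurable_rs lamC1 lamC2 CV (mem_head J V).
have mc (W : seq (set T1 * set T2)) :
    {subset W <= J :: V} -> measurable (rect_cover W).
  move=> WV; apply: measurable_rect_cover => L /WV/CV[? ?]; split.
    exact: (laminar_measurable lamC1).
  exact: (laminar_measurable lamC2).
have GV' : {subset G <= J :: V} by move=> L /GV; rewrite inE orbC => ->.
have mG := mc _ GV'.
have JG : J \notin G by apply: contra JV; exact: GV.
have fJ : (m1 \x m2) (rs J) \is a fin_num.
  rewrite ge0_fin_numE//; apply: le_lt_trans (rect_cover_fin lamC1 lamC2 CV).
  rewrite le_measure ?inE//; first exact: mc.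
  by move=> x Jx; exists J => //; exact: mem_head.
have [large|small] := leP (8^-1%:E * (m1 \x m2) (rs J))
  ((m1 \x m2) (rs J `\` rect_cover G)).
  exists (J :: G), (fun L => if L == J then rs J `\` rect_cover G else E L).
  have EG L : L \in G -> E L `<=` rect_cover G.
    by move=> LG x ELx; have [_ sE _] := GE _ LG; exists L => //; exact: sE.
  split.
  - split; last by rewrite /= JG.
    by move=> L; rewrite !inE => /orP[->//|/GV ->]; rewrite orbT.
  - move=> L M /=; rewrite !inE.
    have [->|LJ] := eqVneq L J; have [->|MJ] := eqVneq M J => //=.
    + by move=> _ MG [x [[_ nGx] EMx]]; case: nGx; exact: (EG _ MG).
    + by move=> LG _ [x [ELx [_ nGx]]]; case: nGx; exact: (EG _ LG).
    + exact: tE.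
  - move=> L; rewrite inE; have [->_|LJ /= LG] := eqVneq L J; last exact: GE.
    by split; [exact: measurableD|move=> x []|exact: large].
  - move=> L; rewrite inE => /orP[/eqP ->|LV].
      rewrite setIidl; last by move=> x Jx; exists J => //; exact: mem_head.
      by rewrite -[leLHS]mul1e; apply: lee_wpmul2r => //; rewrite lee_fin; lra.
    apply: (le_trans (VG _ LV)); apply: lee_wpmul2l => //.
    have mL := measurable_rs lamC1 lamC2 CV' LV.
    apply: le_measure; rewrite ?inE; [exact: measurableI| |].
      apply: measurableI => //; apply: mc => M.
      by rewrite !inE => /orP[->//|/GV ->]; rewrite orbT.
    by move=> x [Lx [M MG Mx]]; split => //; exists M => //; rewrite inE MG orbT.
exists G, E; split => //.
move=> L; rewrite inE => /orP[/eqP ->|]; last exact: VG.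
have fI : (m1 \x m2) (rs J `&` rect_cover G) \is a fin_num.
  rewrite ge0_fin_numE//; apply: (@le_lt_trans _ _ ((m1 \x m2) (rs J))).
    by rewrite le_measure ?inE//; exact: measurableI.
  by rewrite -ge0_fin_numE.
have : (m1 \x m2) (rs J) = (m1 \x m2) (rs J `\` rect_cover G) +
    (m1 \x m2) (rs J `&` rect_cover G) by exact: measureDI.
move: small.
have fD : (m1 \x m2) (rs J `\` rect_cover G) \is a fin_num.
  rewrite ge0_fin_numE//; apply: (@le_lt_trans _ _ ((m1 \x m2) (rs J))).
    by rewrite le_measure ?inE//; exact: measurableD.
  by rewrite -ge0_fin_numE.
have aux (X Y Z : R) : (Y < 8^-1 * X -> X = Y + Z -> 0 <= X -> X <= 2 * Z)%R.
  by move=> *; lra.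
have := measure_ge0 (m1 \x m2) (rs J).
rewrite -(fineK fJ) -(fineK fI) -(fineK fD) -!EFinM -EFinD lte_fin !lee_fin.
move=> J0 lt8 [eqJ]; exact: aux lt8 eqJ (fine_ge0 J0).
Qed.

End Selection.

(** Here p and q stand for the scales of the two sides. The members with larger p have distinct
    integer values in (p i, p i + a i], so their number r i is at most a i; those with smaller p
    have larger q and number l i <= c i. As r i + l i + 1 is the size of C, monotonicity moves every
    weight to one antidiagonal. *)
Lemma chain_sum_le {R : realType} {I : eqType} (C : seq I) (p q : I -> int)
    (a c : I -> nat) (w : nat -> nat -> R) (N : R) :
  uniq C ->
  {in C &, forall i j, i != j -> (p i < p j) && (q j < q i) ||
                                 (p j < p i) && (q i < q j)} ->
  {in C &, forall i j, p j <= p i + (a i)%:Z /\ q j <= q i + (c i)%:Z} ->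
  (forall m m' k, (m <= m')%N -> w m' k <= w m k) ->
  (forall m k k', (k <= k')%N -> w m k' <= w m k) ->
  0 <= N -> (forall n, \sum_(0 <= k < n.+1) w k (n - k)%N <= N) ->
  \sum_(i <- C) w (a i) (c i) <= N.
Proof.
move=> uC ltC leC w1 w2 N0 wN.
pose r i := count (fun j => p i < p j) C; pose l i := count (fun j => p j < p i) C.
have [C0|C0] := eqVneq C [::]; first by rewrite C0 big_nil.
have rl i : i \in C -> (r i + l i).+1 = size C.
  move=> iC; have := count_predC (pred1 i) C; rewrite count_uniq_mem// iC => <-.
  congr S; rewrite -count_predUI.
  rewrite [X in (_ + X)%N](_ : _ = 0) ?addn0; last first.
    apply/eqP; rewrite -leqn0 leqNgt -has_count; apply/hasPn => j _ /=.
    by apply/negP => /andP[/lt_trans h /h]; rewrite ltxx.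
  apply: eq_in_count => j jC /=; have [->|ji] := eqVneq j i; first by rewrite ltxx.
  by have /orP[/andP[-> _]|/andP[-> _]] := ltC _ _ jC iC ji; rewrite ?orbT.
(* Pigeonhole: f j - x - 1 takes distinct values in [0, k). *)
have size_le (f : I -> int) (s : seq I) (k : nat) (x : int) : uniq s ->
    {in s &, forall i j, i != j -> f i != f j} ->
    {in s, forall j, x < f j <= x + k%:Z} -> (size s <= k)%N.
  move=> us inj fs; rewrite -(size_map (fun j => `|f j - x|.-1)%N) -(size_iota 0 k).
  apply: uniq_leq_size.
    rewrite map_inj_in_uniq// => i j si sj; apply: contra_eq => ij.
    have := inj _ _ si sj ij; have := fs _ si; have := fs _ sj; lia.
  move=> _ /mapP[j /fs js ->]; rewrite mem_iota; lia.
have ra i : i \in C -> (r i <= a i)%N.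
  move=> iC; rewrite /r -size_filter; apply: (size_le p _ _ (p i)).
  - exact: filter_uniq.
  - move=> j k; rewrite !mem_filter => /andP[_ jC] /andP[_ kC] jk.
    by have := ltC _ _ jC kC jk; lia.
  - by move=> j; rewrite mem_filter => /andP[-> jC] /=; exact: (leC _ _ iC jC).1.
have lc i : i \in C -> (l i <= c i)%N.
  move=> iC; rewrite /l -size_filter; apply: (size_le q _ _ (q i)).
  - exact: filter_uniq.
  - move=> j k; rewrite !mem_filter => /andP[_ jC] /andP[_ kC] jk.
    by have := ltC _ _ jC kC jk; lia.
  - move=> j; rewrite mem_filter => /andP[ji jC] /=.
    have ij : i != j by apply: contraTneq ji => ->; rewrite ltxx.
    by have := ltC _ _ iC jC ij; have := (leC _ _ iC jC).2; lia.
apply: le_trans (wN (size C).-1).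
apply: (@le_trans _ _ (\sum_(i <- C) w (r i) ((size C).-1 - r i)%N)).
  rewrite big_seq [leRHS]big_seq; apply: ler_sum => i iC.
  apply: (le_trans (w1 _ _ _ (ra i iC))); apply: w2.
  by have := rl i iC; have := lc i iC; lia.
rewrite -(big_map r xpredT (fun k => w k ((size C).-1 - k)%N)).
have sC : (size C).-1.+1 = size C by case: (C) C0.
rewrite sC /index_iota subn0.
(* The ranks r i are distinct and smaller than the size of C, so each value occurs exactly once. *)
suff rC : perm_eq (map r C) (iota 0 (size C)) by rewrite (perm_big _ rC).
have rinj : uniq (map r C).
  rewrite map_inj_in_uniq// => i j iC jC; apply: contra_eq => ij.
  wlog pij : i j iC jC ij / p i < p j.
    move=> h; have /orP[/andP[pij _]|/andP[pji _]] := ltC _ _ iC jC ij.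
      exact: h.
    by rewrite eq_sym; apply: h => //; rewrite eq_sym.
  suff : (r j < r i)%N by move=> /ltn_eqF; rewrite eq_sym => ->.
  rewrite /r -!size_filter.
  apply: (@leq_trans (size (j :: [seq k <- C | p j < p k]))) => //.
  apply: uniq_leq_size.
    by rewrite /= filter_uniq// andbT mem_filter ltxx.
  move=> k; rewrite inE mem_filter => /orP[/eqP ->|/andP[pjk kC]].
    by rewrite mem_filter pij.
  by rewrite mem_filter kC andbT (lt_trans pij).
apply: uniq_perm => //; first exact: iota_uniq.
have := @uniq_min_size _ (map r C) (iota 0 (size C)) rinj.
case => //.
  by move=> _ /mapP[i /rl ri ->]; rewrite mem_iota; lia.
by rewrite size_map size_iota.
Qed.

(** * Dyadic grids *)

Section Cubes.
Context {R : realType}.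

Definition box {d : nat} (a : Rd R d) (s : R) : set (Rd R d) :=
  [set x | forall i, tnth a i <= tnth x i < tnth a i + s].

Lemma measurable_box {d : nat} (a : Rd R d) (s : R) : measurable (box a s).
Proof.
rewrite (_ : box a s = \bigcap_(i in [set: 'I_d])
    ((fun x : Rd R d => tnth x i) @^-1` `[tnth a i, tnth a i + s[%classic)).
  apply: fin_bigcap_measurable => // i _; rewrite -[X in measurable X]setTI.
  exact: measurable_tnth.
apply/seteqP; split => x ax i; first by move=> _; rewrite /= in_itv /= ax.
by have := ax i I; rewrite /= in_itv.
Qed.

Lemma lebesgue_box {d : nat} (a : Rd R d) (s : R) : 0 <= s ->
  lebesgue_Rd R d (box a s) = (s ^+ d)%:E.
Proof.
move=> s0; elim: d a => [|d IHd] a.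
  by rewrite /= diracE mem_set ?expr0// => -[].
rewrite (_ : lebesgue_Rd R d.+1 (box a s) =
  (lebesgue_measure \x lebesgue_Rd R d)%E (@tcons R d @^-1` box a s))//.
have aS i : tnth a (lift ord0 i) = tnth [tuple of behead a] i.
  by rewrite !(tnth_nth 0) /= nth_behead.
have tconsS x y i : tnth (@tcons R d (x, y)) (lift ord0 i) = tnth y i.
  by rewrite !(tnth_nth 0).
rewrite (_ : _ @^-1` _ =
    `[thead a, thead a + s[%classic `*` box [tuple of behead a] s); last first.
  apply/seteqP; split => -[x y] /= axy.
    split; first by have := axy ord0; rewrite /= in_itv.
    by move=> i; have := axy (lift ord0 i); rewrite tconsS aS.
  move=> i; have [j ->|->] := unliftP ord0 i.
    by have := axy.2 j; rewrite tconsS aS.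
  by have := axy.1; rewrite in_itv.
transitivity (lebesgue_measure (`[thead a, (thead a + s)%R[%classic : set R) *
    lebesgue_Rd R d (box [tuple of behead a] s))%E.
  by apply: product_measure1E; [exact: measurable_itv|exact: measurable_box].
rewrite IHd lebesgue_measure_itv /= lte_fin ltrDl exprS.
have [s_gt0|] := ltP 0 s; first by rewrite EFinM -EFinD addrAC subrr add0r.
move=> s_le0; have -> : s = 0 by apply/eqP; rewrite eq_le s_le0.
by rewrite !mul0r mul0e.
Qed.

End Cubes.

Section Grid.
Context {R : realType} {d : nat}.
Hypothesis d_gt0 : (0 < d)%N.

Lemma cube_measure (k : int) (Q : set (Rd R d)) : is_cube k Q ->
  measurable Q /\ lebesgue_Rd R d Q = ((2 ^ k) ^+ d)%:E.
Proof.
move=> [a ->]; split; first exact: measurable_box.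
by rewrite (lebesgue_box a)// exprz_ge0.
Qed.

Lemma is_cube_le (k j : int) (Q P : set (Rd R d)) :
  is_cube k Q -> is_cube j P -> Q `<=` P -> k <= j.
Proof.
move=> /cube_measure[mQ Qk] /cube_measure[mP Pj] QP.
have : (lebesgue_Rd R d Q <= lebesgue_Rd R d P)%E.
  by apply: le_measure; rewrite ?inE.
by rewrite Qk Pj lee_fin ler_pXn2r ?nnegrE ?exprz_ge0// ler_eXz2l// ltr1n.
Qed.

(** In positive dimension the volume determines the side, so [xget] has at most one candidate; 0 is
    the value on sets that are not cubes. *)
Definition scale (Q : set (Rd R d)) : int := xget 0 [set k | is_cube k Q].

Lemma scaleE (k : int) (Q : set (Rd R d)) : is_cube k Q -> scale Q = k.
Proof.
move=> kQ; have : is_cube (scale Q) Q.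
  exact: (xgetPex 0 (ex_intro [set l | is_cube l Q] k kQ)).
by move=> sQ; apply/eqP; rewrite eq_le; apply/andP; split;
  [exact: (is_cube_le sQ kQ)|exact: (is_cube_le kQ sQ)].
Qed.

Variable D : set (set (Rd R d)).
Hypothesis D_grid : dyadic_grid D.

Lemma scaleP (Q : set (Rd R d)) : D Q -> is_cube (scale Q) Q.
Proof. by move=> /(grid_cube D_grid)[k kQ]; rewrite (scaleE kQ). Qed.

Lemma cube_nonempty (Q : set (Rd R d)) : D Q -> Q !=set0.
Proof.
move=> /scaleP[a QE]; exists a; rewrite QE => i /=.
by rewrite lexx ltrDl exprz_gt0.
Qed.

Lemma grid_laminar : laminar (lebesgue_Rd R d) D.
Proof.
split => [Q /scaleP/cube_measure[]//|Q|Q|]; last exact: (grid_nested D_grid).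
- by move=> /scaleP/cube_measure[_ ->]; rewrite lte_fin exprn_gt0// exprz_gt0.
- by move=> /scaleP/cube_measure[_ ->]; rewrite ltry.
Qed.

Lemma scale_le (Q P : set (Rd R d)) : D Q -> D P -> Q `<=` P -> scale Q <= scale P.
Proof. by move=> /scaleP sQ /scaleP sP; exact: (is_cube_le sQ sP). Qed.

(** If instead P is inside Q, the scales agree, and both cubes are the only one of their generation
    through x. *)
Lemma scale_sub (Q P : set (Rd R d)) (x : Rd R d) :
  D Q -> D P -> Q x -> P x -> scale Q <= scale P -> Q `<=` P.
Proof.
move=> DQ DP Qx Px sQP; have [//|PQ|/seteqP[QP0 _]] := grid_nested D_grid DQ DP.
  have sE : scale Q = scale P by apply/eqP; rewrite eq_le sQP scale_le.
  have [S [_ uS]] := grid_partition D_grid (scale Q) x.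
  have -> : Q = S by apply/esym/uS; split => //; exact: scaleP.
  by have -> : P = S by apply/esym/uS; split => //; rewrite sE; exact: scaleP.
by have := QP0 x (conj Qx Px).
Qed.

(** The cube k generations above Q through a point of Q contains Q, so [ancestor] never takes its
    default value here. *)
Lemma ancestorP (k : nat) (Q : set (Rd R d)) : D Q ->
  [/\ D (ancestor D k Q), Q `<=` ancestor D k Q &
      scale (ancestor D k Q) = scale Q + k%:Z].
Proof.
move=> DQ; have [x Qx] := cube_nonempty DQ.
have [P [[DP kP Px] _]] := grid_partition D_grid (scale Q + k%:Z) x.
have QP : Q `<=` P.
  by apply: (scale_sub DQ DP Qx Px); rewrite (scaleE kP) lerDl.
pose A := [set P | [/\ D P, Q `<=` P &
  exists j : int, is_cube j Q /\ is_cube (j + k%:Z) P]].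
have /(xgetPex set0) : exists S, A S.
  by exists P; split => //; exists (scale Q); split => //; exact: scaleP.
rewrite -/(ancestor D k Q) => -[DA QA [j [jQ jA]]]; split => //.
by rewrite (scaleE jA) (scaleE jQ).
Qed.

(** The true ratio is 2^(kd). The weaker factor k already bounds the embeddings and suits the
    Archimedean property. *)
Lemma ancestor_measure_ge (k : nat) (Q : set (Rd R d)) : D Q ->
  (k%:R%:E * lebesgue_Rd R d Q <= lebesgue_Rd R d (ancestor D k Q))%E.
Proof.
move=> DQ; have [DA _ sA] := ancestorP k DQ.
rewrite (cube_measure (scaleP DQ)).2 (cube_measure (scaleP DA)).2 sA -EFinM.
rewrite lee_fin expfzDr// exprMn mulrC; apply: ler_wpM2l.
  by rewrite exprn_ge0// exprz_ge0.
apply: (@le_trans _ _ (2 ^+ k)); first by rewrite -natrX ler_nat ltnW// ltn_expl.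
by rewrite -[leLHS]expr1 -exprnP; apply: ler_weXn2l => //; rewrite exprn_ege1// ler1n.
Qed.

(* Two cubes of the same side whose corners have the same integer parts, in
   units of the side, intersect. *)
Lemma grid_countable : countable D.
Proof.
pose corner (Q : set (Rd R d)) : Rd R d :=
  xget [tuple of nseq d (0 : R)] [set a | Q = box a (2 ^ scale Q)].
pose f Q := (scale Q, [ffun i => Num.floor (tnth (corner Q) i / 2 ^ scale Q)]).
apply/countable_injP.
suff inj : {in D &, injective f}.
  exists (pickle \o f) => Q P QD PD /(pcan_inj pickleK); exact: inj.
move=> Q P /set_mem DQ /set_mem DP [sE /ffunP fE].
have cE S : D S -> S = box (corner S) (2 ^ scale S).
  move=> DS; have [a Sa] := scaleP DS.
  exact: (xgetPex [tuple of nseq d (0 : R)]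
    (ex_intro [set a | S = box a (2 ^ scale S)] a Sa)).
pose z : Rd R d := [tuple Num.max (tnth (corner Q) i) (tnth (corner P) i) | i < d].
have s0 : (0 : R) < 2 ^ scale P by exact: exprz_gt0.
have near i : tnth (corner Q) i < tnth (corner P) i + 2 ^ scale P /\
    tnth (corner P) i < tnth (corner Q) i + 2 ^ scale P.
  have := fE i; rewrite !ffunE sE => fi.
  have := floor_itv (tnth (corner Q) i / 2 ^ scale P : R).
  have := floor_itv (tnth (corner P) i / 2 ^ scale P : R).
  rewrite fi !ler_pdivlMr// !ltr_pdivrMr// !intrD !mulrDl mul1r.
  by move=> /andP[? ?] /andP[? ?]; split; lra.
have Qz : Q z.
  rewrite (cE _ DQ) => i /=; have [lt1 lt2] := near i.
  rewrite tnth_mktuple le_max lexx /= gt_max ltrDl sE s0 /=; lra.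
have Pz : P z.
  rewrite (cE _ DP) => i /=; have [lt1 lt2] := near i.
  by rewrite tnth_mktuple le_max lexx orbT /= gt_max ltrDl s0 andbT.
by apply/seteqP; split; [apply: (scale_sub DQ DP Qz Pz)|
  apply: (scale_sub DP DQ Pz Qz)]; rewrite sE.
Qed.

End Grid.

(** With f an injection into the naturals and g its partial inverse, the n-th list holds the
    elements whose code is below n. *)
Lemma countable_exhaustion {T : choiceType} (U : set T) : countable U ->
  exists e : nat -> seq T, [/\ forall n, uniq (e n),
    forall n x, x \in e n -> U x,
    forall n k, (n <= k)%N -> {subset e n <= e k} &
    forall x, U x -> exists n, x \in e n].
Proof.
move=> /countable_injP[f finj].
pose g k : option T := xget None [set o | exists x, [/\ o = Some x, U x & f x = k]].
have gP k x : g k = Some x -> U x.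
  by rewrite /g; case: xgetP => [_ -> [y [-> Uy _]] [<-]|].
have gf x : U x -> g (f x) = Some x.
  move=> Ux; rewrite /g; case: xgetP => [_ -> [y [-> Uy fy]]|].
    by congr Some; apply: finj; rewrite ?inE.
  by move=> /(_ (Some x)) []; exists x.
exists (fun n => undup (pmap g (iota 0 n))); split.
- by move=> n; exact: undup_uniq.
- move=> n x; rewrite mem_undup mem_pmap => /mapP[k _ kx].
  exact: (gP k).
- move=> n k nk x; rewrite !mem_undup !mem_pmap => /mapP[i].
  rewrite mem_iota add0n => /andP[_ ik] ->; apply: map_f.
  by rewrite mem_iota add0n (leq_trans ik nk).
- move=> x Ux; exists (f x).+1; rewrite mem_undup mem_pmap -(gf _ Ux).
  by apply: map_f; rewrite mem_iota /=.
Qed.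

(** Assuming the successor in A makes A nonempty as well as bounded, so [set_max] is a true maximum
    and contradicts the assumption. *)
Lemma set_maxS (A : set nat) (N : nat) : (forall k, A k -> (k <= N)%N) ->
  ~ A (set_max A).+1.
Proof.
move=> AN AS; have : exists m, A m /\ forall k, A k -> (k <= m)%N.
  have exA : exists k, `[< A k >] by exists (set_max A).+1; exact/asboolP.
  have ubA k : `[< A k >] -> (k <= N)%N by move=> /asboolP; exact: AN.
  have [m /asboolP Am max] := ex_maxnP exA ubA.
  by exists m; split => // k Ak; apply: max; exact/asboolP.
move=> /(xgetPex 0)[_ /(_ _ AS)]; by rewrite ltnn.
Qed.

(** * Borel sets and functions in the completed product *)

Section Completion.
Context {R : realType} {d1 d2 : nat}.
Local Notation la := (lebesgue_Rprod R d1 d2).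
Local Notation mu := (lebesgue_Rd R d1 \x lebesgue_Rd R d2)%E.
Local Open Scope ereal_scope.

Lemma measurable_Rprod (A : set (Rd R d1 * Rd R d2)) : measurable A ->
  measurable (A : set (Rprod R d1 d2)).
Proof. exact: caratheodory_measurable_mu_ext. Qed.

Lemma lebesgue_RprodE (A : set (Rd R d1 * Rd R d2)) : measurable A ->
  la A = mu A.
Proof. exact: measurable_mu_extE. Qed.

Lemma measurable_fun_Rprod (f : Rd R d1 * Rd R d2 -> \bar R) :
  measurable_fun setT f -> measurable_fun setT (f : Rprod R d1 d2 -> \bar R).
Proof. by move=> mf _ Y mY; apply: measurable_Rprod; exact: mf. Qed.

(** The identity is measurable from the completion to the Borel product and pushes the completed
    measure forward to the product measure. *)
Lemma integral_Rprod (f : Rd R d1 * Rd R d2 -> \bar R) :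
  measurable_fun setT f -> (forall x, 0 <= f x) ->
  \int[la]_x f x = \int[mu]_x f x.
Proof.
move=> mf f0.
pose phi : Rprod R d1 d2 -> Rd R d1 * Rd R d2 := id.
have mphi : measurable_fun setT phi.
  by move=> _ Y mY; rewrite setTI; exact: measurable_Rprod.
have := @ge0_integral_pushforward _ _ _ _ R phi mphi la setT f measurableT mf
  (fun y _ => f0 y).
rewrite preimage_setT => <-.
apply: eq_measure_integral => A mA _.
by rewrite /pushforward /= -lebesgue_RprodE.
Qed.

(** The covering inequalities take Borel sets, while [Omega] is only Lebesgue measurable. A hull of
    finite measure suffices, since it serves only to bound the embeddings. *)
Lemma measurable_hull (Omega : set (Rprod R d1 d2)) : la Omega < +oo ->
  exists B : set (Rd R d1 * Rd R d2),
    [/\ measurable B, Omega `<=` B & mu B < +oo].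
Proof.
move=> /ereal_inf_lt[_ [F [mF OF] <-] Foo].
have mUF : measurable (\bigcup_k F k : set (Rd R d1 * Rd R d2)).
  by apply: bigcupT_measurable => k; exact: mF.
exists (\bigcup_k F k); split => //.
by apply: le_lt_trans Foo; apply: measure_sigma_subadditive.
Qed.

End Completion.

(** * The enlarged set and embeddings *)

Section Enlarged.
Context {R : realType} {d1 d2 : nat}.
Hypotheses (d1_gt0 : (0 < d1)%N) (d2_gt0 : (0 < d2)%N).
Variables (D1 : set (set (Rd R d1))) (D2 : set (set (Rd R d2))).
Hypotheses (D1_grid : dyadic_grid D1) (D2_grid : dyadic_grid D2).
Local Notation la := (lebesgue_Rprod R d1 d2).
Local Notation m1 := (lebesgue_Rd R d1).
Local Notation m2 := (lebesgue_Rd R d2).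
Local Notation mu := (lebesgue_Rd R d1 \x lebesgue_Rd R d2)%E.
Local Open Scope ereal_scope.

Let lam1 := grid_laminar d1_gt0 D1_grid.
Let lam2 := grid_laminar d2_gt0 D2_grid.

Lemma measurable_rect (J : rect R d1 d2) : (D1 `*` D2) J ->
  measurable (J.1 `*` J.2).
Proof.
move=> [J1 J2]; apply: measurableX.
- exact: (laminar_measurable lam1).
- exact: (laminar_measurable lam2).
Qed.

Lemma mu_rect (J : rect R d1 d2) : (D1 `*` D2) J ->
  mu (J.1 `*` J.2) = m1 J.1 * m2 J.2.
Proof.
move=> [J1 J2]; apply: product_measure1E.
- exact: (laminar_measurable lam1).
- exact: (laminar_measurable lam2).
Qed.

Lemma mu_rect_gt0 (J : rect R d1 d2) : (D1 `*` D2) J -> 0 < mu (J.1 `*` J.2).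
Proof.
by move=> DJ; rewrite mu_rect//; case: DJ => J1 J2;
  rewrite mule_gt0// ?(laminar_gt0 lam1)// (laminar_gt0 lam2).
Qed.

Lemma mu_rect_fin (J : rect R d1 d2) : (D1 `*` D2) J ->
  mu (J.1 `*` J.2) \is a fin_num.
Proof.
move=> DJ; rewrite mu_rect//; case: DJ => J1 J2; apply: fin_numM.
- by rewrite ge0_fin_numE// (laminar_fin lam1).
- by rewrite ge0_fin_numE// (laminar_fin lam2).
Qed.

Lemma maximal_average (Omega : set (Rprod R d1 d2)) (J : rect R d1 d2) :
  measurable Omega -> (D1 `*` D2) J ->
  (2^-1%:E < (\int[la]_(y in rset J) `|\1_Omega y : R|%:E) / la (rset J)) =
  (mu (J.1 `*` J.2) < 2%:E * la (rset J `&` Omega)).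
Proof.
move=> mO DJ; have mJ := measurable_Rprod (measurable_rect DJ).
under eq_integral do rewrite ger0_norm//.
rewrite integral_indic// setIC.
have -> : la (rset J) = mu (J.1 `*` J.2).
  by rewrite lebesgue_RprodE//; exact: measurable_rect.
have := mu_rect_gt0 DJ; rewrite -(fineK (mu_rect_fin DJ)) lte_fin => J_gt0.
by rewrite inver gt_eqF// lte_pdivlMr// lte_pdivrMl.
Qed.

Lemma enlarged_rect (Omega : set (Rprod R d1 d2)) (J : rect R d1 d2) :
  measurable Omega -> (D1 `*` D2) J ->
  mu (J.1 `*` J.2) < 2%:E * la (rset J `&` Omega) ->
  rset J `<=` enlarged D1 D2 Omega.
Proof.
move=> mO DJ; rewrite -maximal_average// => ltJ x Jx.
apply: (lt_le_trans ltJ); apply: ereal_sup_ubound; exists J => //.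
Qed.

Lemma enlargedP (Omega : set (Rprod R d1 d2)) (x : Rprod R d1 d2) :
  measurable Omega -> enlarged D1 D2 Omega x ->
  exists J : rect R d1 d2, [/\ (D1 `*` D2) J, rset J x &
    mu (J.1 `*` J.2) < 2%:E * la (rset J `&` Omega)].
Proof.
move=> mO /ereal_sup_gt[_ [J [DJ Jx] <-]]; rewrite maximal_average// => ltJ.
by exists J.
Qed.

Lemma countable_rects : countable (D1 `*` D2).
Proof.
by apply: countableX; [exact: (grid_countable d1_gt0)|exact: (grid_countable d2_gt0)].
Qed.

Lemma exhausted_cover_cvg (U : set (rect R d1 d2)) (e : nat -> seq (rect R d1 d2)) :
  U `<=` D1 `*` D2 -> (forall n I, I \in e n -> U I) ->
  (forall n k, (n <= k)%N -> {subset e n <= e k}) ->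
  (forall I, U I -> exists n, I \in e n) ->
  measurable (sh U : set (Rd R d1 * Rd R d2)) /\
  mu (rect_cover (e n)) @[n --> \oo] --> mu (sh U).
Proof.
move=> UD eU emono Ue.
have shE : sh U = \bigcup_n rect_cover (e n) :> set (Rd R d1 * Rd R d2).
  apply/seteqP; split => x [].
    by move=> J UJ Jx; have [n Jn] := Ue _ UJ; exists n => //; exists J.
  by move=> n _ [J Jn Jx]; exists J => //; exact: (eU n).
have me n : measurable (rect_cover (e n)).
  rewrite rect_coverE big_seq; apply: bigsetU_measurable => J /eU/UD.
  exact: measurable_rect.
have mU : measurable (\bigcup_n rect_cover (e n)) by exact: bigcup_measurable.
rewrite shE; split => //; apply: (nondecreasing_cvg_mu me mU).
by move=> n k nk; apply/subsetPset => x [J Jn Jx]; exists J => //; exact: (emono n).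
Qed.

(** The enlarged set lies in the union of the grid rectangles at least half filled by B. These are
    countably many, so [strong_cover] on finite lists passes to the limit. *)
Lemma enlarged_measure_le (Omega : set (Rprod R d1 d2))
    (A B : set (Rd R d1 * Rd R d2)) :
  measurable Omega -> measurable B -> Omega `<=` B ->
  measurable A -> A `<=` enlarged D1 D2 Omega -> mu A <= 16%:E * mu B.
Proof.
move=> mO mB OB mA AO.
pose U := [set J : rect R d1 d2 | (D1 `*` D2) J /\
  mu (J.1 `*` J.2) <= 2%:E * mu ((J.1 `*` J.2) `&` B)].
have UD : U `<=` D1 `*` D2 by move=> J [].
have cU : countable U by exact: sub_countable (subset_card_le UD) countable_rects.
have [e [ue eU emono Ue]] := countable_exhaustion cU.
have [mU cvgU] := exhausted_cover_cvg UD eU emono Ue.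
apply: (@le_trans _ _ (mu (sh U))).
  rewrite le_measure ?inE// => x /AO /(enlargedP mO)[J [DJ Jx ltJ]].
  exists J => //; split => //; apply: (le_trans (ltW ltJ)).
  apply: lee_wpmul2l => //; rewrite -lebesgue_RprodE; last first.
    by apply: measurableI => //; exact: measurable_rect.
  by apply: le_outer_measure => y [Jy /OB].
rewrite -(cvg_lim _ cvgU)//; apply: lime_le; first by apply/cvg_ex; eexists; exact: cvgU.
apply: nearW => n; apply: (strong_cover lam1 lam2) => // J /eU[[? ?] ?].
by split.
Qed.

(** If the k-th ancestor rectangle is in the enlarged set, then k |I| <= 16 |B| for a Borel hull B
    of [Omega]; hence k is bounded and [set_maxS] applies. *)
Lemma embed1_max (Omega : set (Rprod R d1 d2)) (I : rect R d1 d2) :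
  measurable Omega -> la Omega < +oo -> (D1 `*` D2) I ->
  ~ rset (ancestor D1 (embed1 D1 D2 I Omega).+1 I.1, I.2)
    `<=` enlarged D1 D2 Omega.
Proof.
move=> mO Ooo DI; have [B [mB OB Boo]] := measurable_hull Ooo.
have fB : mu B \is a fin_num by rewrite ge0_fin_numE.
have fI := mu_rect_fin DI; have gtI := mu_rect_gt0 DI.
apply: (@set_maxS [set k | rset (ancestor D1 k I.1, I.2) `<=` enlarged D1 D2 Omega]
  (Num.bound (16 * fine (mu B) / fine (mu (I.1 `*` I.2)))%R)).
move=> k kO; have [DA QA _] := ancestorP d1_gt0 D1_grid k DI.1.
have DAI : (D1 `*` D2) (ancestor D1 k I.1, I.2) by split => //; exact: DI.2.
have := enlarged_measure_le mO mB OB (measurable_rect DAI) kO.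
rewrite mu_rect//= => leB.
have : k%:R%:E * mu (I.1 `*` I.2) <= 16%:E * mu B.
  apply: le_trans leB; rewrite mu_rect// muleA; apply: lee_wpmul2r => //.
  exact: (ancestor_measure_ge d1_gt0 D1_grid k DI.1).
move: gtI; rewrite -(fineK fI) -(fineK fB) -!EFinM lee_fin lte_fin => gtI lek.
rewrite -(ler_nat R).
apply: (@le_trans _ _ (16 * fine (mu B) / fine (mu (I.1 `*` I.2)))%R).
  by rewrite ler_pdivlMr.
by apply/ltW/archi_boundP; rewrite divr_ge0 ?mulr_ge0// ?fine_ge0// ltW.
Qed.

Lemma embed2_max (Omega : set (Rprod R d1 d2)) (I : rect R d1 d2) :
  measurable Omega -> la Omega < +oo -> (D1 `*` D2) I ->
  ~ rset (I.1, ancestor D2 (embed2 D1 D2 I Omega).+1 I.2)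
    `<=` enlarged D1 D2 Omega.
Proof.
move=> mO Ooo DI; have [B [mB OB Boo]] := measurable_hull Ooo.
have fB : mu B \is a fin_num by rewrite ge0_fin_numE.
have fI := mu_rect_fin DI; have gtI := mu_rect_gt0 DI.
apply: (@set_maxS [set k | rset (I.1, ancestor D2 k I.2) `<=` enlarged D1 D2 Omega]
  (Num.bound (16 * fine (mu B) / fine (mu (I.1 `*` I.2)))%R)).
move=> k kO; have [DA QA _] := ancestorP d2_gt0 D2_grid k DI.2.
have DAI : (D1 `*` D2) (I.1, ancestor D2 k I.2) by split => //; exact: DI.1.
have := enlarged_measure_le mO mB OB (measurable_rect DAI) kO.
rewrite mu_rect//= => leB.
have : k%:R%:E * mu (I.1 `*` I.2) <= 16%:E * mu B.
  apply: le_trans leB; rewrite mu_rect// muleCA; apply: lee_wpmul2l => //.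
  exact: (ancestor_measure_ge d2_gt0 D2_grid k DI.2).
move: gtI; rewrite -(fineK fI) -(fineK fB) -!EFinM lee_fin lte_fin => gtI lek.
rewrite -(ler_nat R).
apply: (@le_trans _ _ (16 * fine (mu B) / fine (mu (I.1 `*` I.2)))%R).
  by rewrite ler_pdivlMr.
by apply/ltW/archi_boundP; rewrite divr_ge0 ?mulr_ge0// ?fine_ge0// ltW.
Qed.

End Enlarged.

(** * The Carleson condition for the embedding weights *)

Section WeightCarleson.
Context {R : realType} {d1 d2 : nat}.
Hypotheses (d1_gt0 : (0 < d1)%N) (d2_gt0 : (0 < d2)%N).
Variables (D1 : set (set (Rd R d1))) (D2 : set (set (Rd R d2))).
Hypotheses (D1_grid : dyadic_grid D1) (D2_grid : dyadic_grid D2).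
Variables (Omega : set (Rprod R d1 d2)) (U : set (rect R d1 d2)).
Hypothesis adm : admissible_pair D1 D2 Omega U.
Local Notation la := (lebesgue_Rprod R d1 d2).
Local Notation m1 := (lebesgue_Rd R d1).
Local Notation m2 := (lebesgue_Rd R d2).
Local Notation mu := (lebesgue_Rd R d1 \x lebesgue_Rd R d2)%E.

Let lam1 := grid_laminar d1_gt0 D1_grid.
Let lam2 := grid_laminar d2_gt0 D2_grid.

Lemma admissible_incomparable (I J : rect R d1 d2) : U I -> U J ->
  I.1 `<=` J.1 -> I.2 `<=` J.2 -> I = J.
Proof.
move=> UI UJ s1 s2; apply: (adm_incomparable adm) => // x [Ix1 Ix2].
by split; [exact: s1|exact: s2].
Qed.

Variable V : seq (rect R d1 d2).
Hypotheses (uV : uniq V) (VU : forall I, I \in V -> U I).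

Local Notation a I := (embed1 D1 D2 I Omega).
Local Notation c I := (embed2 D1 D2 I Omega).
(** One generation beyond the embedding: with this side, the rectangle is no longer contained in the
    enlarged set. *)
Let anc1 (I : rect R d1 d2) := ancestor D1 (a I).+1 I.1.
Let anc2 (I : rect R d1 d2) := ancestor D2 (c I).+1 I.2.

(* The members removed in one variable stretch beyond the embedding of I in the
   other one: if they covered half of that side of I, an ancestor of I would be
   half in Omega, against the maximality of the embedding. *)
Definition core1 (I : rect R d1 d2) : set (Rd R d1) :=
  I.1 `\` \big[setU/set0]_(J <-
    [seq J <- V | `[< anc2 I `<=` J.2 /\ J.1 `<=` I.1 >]]) J.1.
Definition core2 (I : rect R d1 d2) : set (Rd R d2) :=
  I.2 `\` \big[setU/set0]_(J <-
    [seq J <- V | `[< anc1 I `<=` J.1 /\ J.2 `<=` I.2 >]]) J.2.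

Let half_complement {d} {T : measurableType d} (m : {measure set T -> \bar R})
    (A C : set T) : measurable A -> measurable C -> C `<=` A ->
  m A \is a fin_num -> ~ (m A < 2%:E * m C)%E -> (m A <= 2%:E * m (A `\` C))%E.
Proof.
move=> mA mC CA fA.
have fC : m C \is a fin_num.
  by rewrite ge0_fin_numE// (le_lt_trans (le_measure m _ _ CA)) ?inE// -ge0_fin_numE.
have fD : m (A `\` C) \is a fin_num.
  rewrite ge0_fin_numE//; apply: (@le_lt_trans _ _ (m A)); last by rewrite -ge0_fin_numE.
  by rewrite le_measure ?inE//; exact: measurableD.
have : (m A = m (A `\` C) + m C)%E.
  by rewrite (measureDI m mA mC) (setIidr CA).
rewrite -(fineK fA) -(fineK fC) -(fineK fD) -EFinD => -[->].
by rewrite -!EFinM lte_fin lee_fin => /negP; rewrite -leNgt => ?; lra.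
Qed.

Lemma core2_half (I : rect R d1 d2) : I \in V ->
  [/\ measurable (core2 I), core2 I `<=` I.2 & (m2 I.2 <= 2%:E * m2 (core2 I))%E].
Proof.
move=> IV; have UI := VU IV; have DI := adm_rect adm UI.
rewrite /core2; set s := [seq _ <- _ | _]; set C := \big[_/_]_(_ <- _) _.
have sV J : J \in s -> [/\ U J, anc1 I `<=` J.1 & J.2 `<=` I.2].
  by rewrite mem_filter => /andP[/asboolP[? ?] /VU].
have mI2 := laminar_measurable lam2 DI.2.
have mC : measurable C.
  rewrite /C big_seq; apply: bigsetU_measurable => J /sV[/(adm_rect adm)[_ ?] _ _].
  exact: (laminar_measurable lam2).
have CE y : C y -> exists2 J, J \in s & J.2 y.
  by rewrite /C -bigcup_seq => -[J /= Js Jy]; exists J.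
split; [exact: measurableD|by move=> y []|].
apply: half_complement => //.
- by move=> y /CE[J /sV[_ _]]; exact.
- by rewrite ge0_fin_numE// (laminar_fin lam2 DI.2).
(* Every removed J has [anc1 I] inside J.1, so the product of [anc1 I] and C lies in [Omega]. With C
   more than half of I.2, the rectangle [(anc1 I, I.2)] would be more than half in [Omega], hence in
   the enlarged set. *)
move=> ltC; apply: (embed1_max d1_gt0 d2_gt0 D1_grid D2_grid
  (adm_measurable adm) (adm_finite adm) DI).
have [DA IA _] := ancestorP d1_gt0 D1_grid (a I).+1 DI.1.
have DAI : (D1 `*` D2) (anc1 I, I.2) by split => //; exact: DI.2.
have mA := laminar_measurable lam1 DA.
apply: (enlarged_rect d1_gt0 d2_gt0 D1_grid D2_grid (adm_measurable adm)) => //.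
apply: (@lt_le_trans _ _ (2%:E * mu (anc1 I `*` C))%E); last first.
  apply: lee_wpmul2l => //; rewrite -lebesgue_RprodE; last exact: measurableX.
  apply: le_outer_measure => -[x y] [/= Ax Cy]; split.
    by split => //=; have [J /sV[_ _]] := CE _ Cy; exact.
  have [J /sV[UJ AJ _] Jy] := CE _ Cy.
  by apply: (adm_sub adm UJ); split => //=; exact: AJ.
rewrite (mu_rect d1_gt0 d2_gt0 D1_grid D2_grid)//=.
rewrite [mu _](_ : _ = m1 (anc1 I) * m2 C)%E; last exact: product_measure1E.
rewrite muleCA lte_pmul2l//.
- by rewrite ge0_fin_numE// (laminar_fin lam1 DA).
- exact: (laminar_gt0 lam1 DA).
Qed.

Lemma core1_half (I : rect R d1 d2) : I \in V ->
  [/\ measurable (core1 I), core1 I `<=` I.1 & (m1 I.1 <= 2%:E * m1 (core1 I))%E].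
Proof.
move=> IV; have UI := VU IV; have DI := adm_rect adm UI.
rewrite /core1; set s := [seq _ <- _ | _]; set C := \big[_/_]_(_ <- _) _.
have sV J : J \in s -> [/\ U J, anc2 I `<=` J.2 & J.1 `<=` I.1].
  by rewrite mem_filter => /andP[/asboolP[? ?] /VU].
have mI1 := laminar_measurable lam1 DI.1.
have mC : measurable C.
  rewrite /C big_seq; apply: bigsetU_measurable => J /sV[/(adm_rect adm)[? _] _ _].
  exact: (laminar_measurable lam1).
have CE x : C x -> exists2 J, J \in s & J.1 x.
  by rewrite /C -bigcup_seq => -[J /= Js Jx]; exists J.
split; [exact: measurableD|by move=> x []|].
apply: half_complement => //.
- by move=> x /CE[J /sV[_ _]]; exact.
- by rewrite ge0_fin_numE// (laminar_fin lam1 DI.1).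
move=> ltC; apply: (embed2_max d1_gt0 d2_gt0 D1_grid D2_grid
  (adm_measurable adm) (adm_finite adm) DI).
have [DA IA _] := ancestorP d2_gt0 D2_grid (c I).+1 DI.2.
have DAI : (D1 `*` D2) (I.1, anc2 I) by split => //; exact: DI.1.
have mA := laminar_measurable lam2 DA.
apply: (enlarged_rect d1_gt0 d2_gt0 D1_grid D2_grid (adm_measurable adm)) => //.
apply: (@lt_le_trans _ _ (2%:E * mu (C `*` anc2 I))%E); last first.
  apply: lee_wpmul2l => //; rewrite -lebesgue_RprodE; last exact: measurableX.
  apply: le_outer_measure => -[x y] [/= Cx Ay]; split.
    by split => //=; have [J /sV[_ _]] := CE _ Cx; exact.
  have [J /sV[UJ AJ _] Jx] := CE _ Cx.
  by apply: (adm_sub adm UJ); split => //=; exact: AJ.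
rewrite (mu_rect d1_gt0 d2_gt0 D1_grid D2_grid)//=.
rewrite [mu _](_ : _ = m1 C * m2 (anc2 I))%E; last exact: product_measure1E.
rewrite muleA lte_pmul2r//.
- by rewrite ge0_fin_numE// (laminar_fin lam2 DA).
- exact: (laminar_gt0 lam2 DA).
Qed.

Variable w : nat -> nat -> R.
Hypothesis w_adm : admissible_weight w.

Lemma ft_norm_fin : ft_norm w \is a fin_num.
Proof.
rewrite ge0_fin_numE; first exact: (weight_fin w_adm).
apply: (@le_trans _ _ (\sum_(0 <= k < 1) w k (0 - k)%N)%:E).
  by rewrite lee_fin sumr_ge0// => k _; exact: (weight_ge0 w_adm).
by apply: ereal_sup_ubound; exists 0%N.
Qed.

Lemma ft_norm_ge n : \sum_(0 <= k < n.+1) w k (n - k)%N <= fine (ft_norm w).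
Proof.
by rewrite -lee_fin (fineK ft_norm_fin); apply: ereal_sup_ubound; exists n.
Qed.

Lemma ft_norm_ge0 : 0 <= fine (ft_norm w).
Proof.
apply: le_trans (ft_norm_ge 0).
by rewrite sumr_ge0// => k _; exact: (weight_ge0 w_adm).
Qed.

(** The members whose cores contain x share a point, so their sides are nested as their scales are
    ordered, and incomparability orders the two scales in opposite ways. This is the chain to which
    [chain_sum_le] applies. *)
Lemma core_overlap (x : Rd R d1 * Rd R d2) :
  \sum_(I <- V) rect_weight D1 D2 w I Omega * \1_(core1 I `*` core2 I) x <=
    fine (ft_norm w).
Proof.
rewrite (eq_bigr (fun I => if x \in core1 I `*` core2 I then
    rect_weight D1 D2 w I Omega else 0)); last first.
  by move=> I _; rewrite indicE; case: (_ \in _); rewrite ?mulr1 ?mulr0.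
rewrite -big_mkcond -big_filter.
set C := [seq _ <- _ | _].
have CP I : I \in C -> [/\ I \in V, core1 I x.1 & core2 I x.2].
  by rewrite mem_filter => /andP[/set_mem[]].
have sub1 I J : I \in C -> J \in C -> scale I.1 <= scale J.1 -> I.1 `<=` J.1.
  move=> /CP[/VU/(adm_rect adm)[DI _] [Ix _] _].
  move=> /CP[/VU/(adm_rect adm)[DJ _] [Jx _] _].
  exact: (scale_sub d1_gt0 D1_grid DI DJ Ix Jx).
have sub2 I J : I \in C -> J \in C -> scale I.2 <= scale J.2 -> I.2 `<=` J.2.
  move=> /CP[/VU/(adm_rect adm)[_ DI] _ [Ix _]].
  move=> /CP[/VU/(adm_rect adm)[_ DJ] _ [Jx _]].
  exact: (scale_sub d2_gt0 D2_grid DI DJ Ix Jx).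
have ltC : {in C &, forall I J, I != J ->
    (scale I.1 < scale J.1) && (scale J.2 < scale I.2) ||
    (scale J.1 < scale I.1) && (scale I.2 < scale J.2)}.
  move=> I J IC JC; have [IV _ _] := CP _ IC; have [JV _ _] := CP _ JC.
  apply: contraNT; rewrite negb_or !negb_and -!leNgt => /andP[h1 h2].
  have [le1|/ltW ge1] := leP (scale I.1) (scale J.1).
    have [le2|gt2] := leP (scale I.2) (scale J.2).
      apply/eqP; apply: admissible_incomparable; [exact: VU|exact: VU| |].
        exact: sub1.
      exact: sub2.
    have ge1 : scale J.1 <= scale I.1 by move: h1; rewrite [X in _ || X]leNgt gt2 orbF.
    apply/eqP/esym; apply: admissible_incomparable; [exact: VU|exact: VU| |].
      exact: sub1.
    by apply: sub2 => //; exact: ltW.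
  have [le2|gt2] := leP (scale J.2) (scale I.2).
    apply/eqP/esym; apply: admissible_incomparable; [exact: VU|exact: VU| |].
      exact: sub1.
    exact: sub2.
  have le1 : scale I.1 <= scale J.1 by move: h2; rewrite [X in _ || X]leNgt gt2 orbF.
  apply/eqP; apply: admissible_incomparable; [exact: VU|exact: VU| |].
    exact: sub1.
  by apply: sub2 => //; exact: ltW.
apply: (@chain_sum_le _ _ C (fun I => scale I.1) (fun I => scale I.2)
  (fun I => a I) (fun I => c I)) => //.
- exact: filter_uniq.
- move=> I J IC JC; have [IV [Ix1 nIx1] [Ix2 nIx2]] := CP _ IC.
  have [JV [Jx1 _] [Jx2 _]] := CP _ JC.
  have [DI1 DI2] := adm_rect adm (VU IV); have [DJ1 DJ2] := adm_rect adm (VU JV).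
  split; rewrite leNgt; apply/negP => gtI.
  (* If J.1 were more than e_1(I) generations above I.1, it would contain [anc1 I] while J.2 is
     inside I.2; then x.2 would have been removed from [core2 I]. *)
  + have [DA IA sA] := ancestorP d1_gt0 D1_grid (a I).+1 DI1.
    have IJ : I != J by apply: contraTneq gtI => ->; rewrite -leNgt lerDl.
    apply: nIx2; rewrite -bigcup_seq; exists J => //=.
    rewrite mem_filter JV andbT; apply/asboolP; split.
      apply: (scale_sub d1_gt0 D1_grid DA DJ1 (IA _ Ix1) Jx1).
      by rewrite sA; move: gtI => /=; lia.
    by apply: sub2 => //; have := ltC _ _ IC JC IJ; move: gtI => /=; lia.
  + have [DA IA sA] := ancestorP d2_gt0 D2_grid (c I).+1 DI2.
    have IJ : I != J by apply: contraTneq gtI => ->; rewrite -leNgt lerDl.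
    apply: nIx1; rewrite -bigcup_seq; exists J => //=.
    rewrite mem_filter JV andbT; apply/asboolP; split.
      apply: (scale_sub d2_gt0 D2_grid DA DJ2 (IA _ Ix2) Jx2).
      by rewrite sA; move: gtI => /=; lia.
    by apply: sub1 => //; have := ltC _ _ IC JC IJ; move: gtI => /=; lia.
- by move=> m m' k mm'; exact: (weight_nincr1 w_adm).
- by move=> m k k' kk'; exact: (weight_nincr2 w_adm).
- exact: ft_norm_ge0.
- exact: ft_norm_ge.
Qed.

Lemma weight_carleson :
  (\sum_(I <- V) (rect_weight D1 D2 w I Omega)%:E * mu (I.1 `*` I.2) <=
    (4 * fine (ft_norm w))%:E * mu (rect_cover V))%E.
Proof.
apply: (bounded_overlap_carleson lam1 lam2 _ _ core1_half core2_half core_overlap).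
- by move=> I /VU/(adm_rect adm)[].
- by move=> I; exact: (weight_ge0 w_adm).
Qed.

End WeightCarleson.

(** * Sums over a countable family as limits along an exhaustion *)

Section ExhaustionLimit.
Context {T : choiceType} {R : realType}.
Variables (U : set T) (e : nat -> seq T).
Hypotheses (ue : forall n, uniq (e n)) (eU : forall n x, x \in e n -> U x)
  (emono : forall n k, (n <= k)%N -> {subset e n <= e k})
  (Ue : forall x, U x -> exists n, x \in e n).

Lemma esum_exhaustion_ge (a : T -> \bar R) n :
  (\sum_(x <- e n) a x <= \esum_(x in U) a x)%E.
Proof.
apply: esum_ge; exists [set` e n]; last by rewrite fsbig_seq.
by split; [exact: finite_seq|exact: eU].
Qed.

Lemma esum_exhaustion_le (a : T -> \bar R) (M : \bar R) :
  (forall x, (0 <= a x)%E) -> (forall n, (\sum_(x <- e n) a x <= M)%E) ->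
  (\esum_(x in U) a x <= M)%E.
Proof.
move=> a0 aM; apply: ge_ereal_sup => _ [A [fA AU] <-].
have [n An] : exists n, A `<=` [set` e n].
  move/finite_seqP: fA AU => [s ->]; elim: s => [|x s IHs] sU.
    by exists 0%N.
  have [|n sn] := IHs; first by move=> y ys; apply: sU; rewrite /= inE ys orbT.
  have [k xk] := Ue (sU x (mem_head _ _)).
  exists (maxn n k) => y /=; rewrite inE => /orP[/eqP ->|ys].
    by apply: emono xk; exact: leq_maxr.
  by apply: (emono (leq_maxl n k)); exact: sn.
apply: le_trans (aM n); rewrite [leRHS]fsbig_seq//; apply: lee_fsum_nneg_subset => //.
by move=> x; rewrite !inE => /An.
Qed.

Lemma sum_exhaustion_le (v : T -> R) n k : (forall x, 0 <= v x) ->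
  (n <= k)%N -> \sum_(x <- e n) v x <= \sum_(x <- e k) v x.
Proof.
move=> v0 nk; rewrite -lee_fin -!sumEFin [leLHS]fsbig_seq// [leRHS]fsbig_seq//.
apply: lee_fsum_nneg_subset => //.
- by move=> x; rewrite !inE; exact: emono.
- by move=> x _; rewrite lee_fin.
Qed.

(** The sequence is nondecreasing, so only its supremum has to be identified; both sides may be
    infinite. *)
Lemma cvg_exp_esum (v : T -> R) (c : R) : 0 < c -> (forall x, 0 <= v x) ->
  (expR (c * \sum_(x <- e n) v x) - 1)%:E @[n --> \oo] -->
    (expeR (c%:E * \esum_(x in U) (v x)%:E) - 1)%E.
Proof.
move=> c0 v0; set f := fun n => (expR (c * \sum_(x <- e n) v x) - 1)%:E.
have fle n k : (n <= k)%N -> (f n <= f k)%E.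
  move=> nk; rewrite lee_fin lerD2r ler_expR ler_pM2l//.
  exact: sum_exhaustion_le.
suff -> : (expeR (c%:E * \esum_(x in U) (v x)%:E) - 1)%E = ereal_sup (range f).
  exact: ereal_nondecreasing_cvgn.
have e0 : (0 <= \esum_(x in U) (v x)%:E)%E by apply: esum_ge0 => x _; rewrite lee_fin.
apply/eqP; rewrite eq_le; apply/andP; split; last first.
  apply: ge_ereal_sup => _ [n _ <-].
  rewrite /f EFinB leeB// -[leLHS]/(expeR (_ * _)%:E) lee_expeR EFinM.
  apply: lee_wpmul2l; first by rewrite lee_fin ltW.
  by rewrite -sumEFin; exact: esum_exhaustion_ge.
have f_ub n : (f n <= ereal_sup (range f))%E by apply: ereal_sup_ubound; exists n.
have f0 n : (0 <= f n)%E.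
  rewrite lee_fin subr_ge0 -[leLHS]expR0 ler_expR; apply: mulr_ge0; first exact: ltW.
  by apply: sumr_ge0 => x _; exact: v0.
case: (ereal_sup (range f)) f_ub => [r||] f_ub.
(* A finite supremum r bounds all partial sums by c^-1 ln (1 + r), hence also the full sum. *)
- have r0 : 0 <= r by rewrite -lee_fin (le_trans (f0 0%N)).
  have le_ln n : (\sum_(x <- e n) v x <= c^-1 * ln (1 + r)).
    rewrite ler_pdivlMl// -ler_expR lnK ?posrE; last by rewrite ltr_wpDr.
    by have := f_ub n; rewrite lee_fin lerBlDl.
  have : (\esum_(x in U) (v x)%:E <= (c^-1 * ln (1 + r))%:E)%E.
    apply: esum_exhaustion_le => [x|n]; first by rewrite lee_fin.
    by rewrite sumEFin lee_fin.
  move: e0; case: (esum _ _) => [s||]// s0; rewrite lee_fin ler_pdivlMl// => les.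
  rewrite -EFinM /= -EFinB lee_fin lerBlDl -[leRHS]lnK ?ler_expR//.
  by rewrite posrE ltr_wpDr.
- by rewrite leey.
- by have := le_trans (f0 0%N) (f_ub 0%N).
Qed.

End ExhaustionLimit.

Section Constants.
Context {R : realType}.

Lemma expR_t0 : expR (t0 R) = 257 / 256.
Proof. by rewrite /t0 lnK ?posrE; lra. Qed.

Lemma t0_gt0 : 0 < t0 R.
Proof. by rewrite /t0 ln_gt0//; lra. Qed.

Lemma t0_le : t0 R <= 256^-1.
Proof. by apply: le_ln1Dx; lra. Qed.

(** This is 1 - y <= exp (-y), multiplied by exp y. *)
Lemma expRB1_le (y : R) : expR y - 1 <= y * expR y.
Proof.
have := expR_ge1Dx (- y); rewrite expRN => le1.
have := ler_wpM2l (ltW (expR_gt0 y)) le1.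
by rewrite divff ?gt_eqF ?expR_gt0// mulrDr mulr1 mulrN mulrC => ?; lra.
Qed.

End Constants.

Lemma wprod_exp {I T : Type} {R : realType} (V : seq I) (K : I -> set T)
    (v : I -> R) (x : T) :
  wprod V K (fun J => expR (v J) - 1) x = expR (\sum_(J <- V) v J * \1_(K J) x).
Proof.
rewrite /wprod expR_sum; apply: eq_bigr => J _; rewrite indicE.
by case: (_ \in _); rewrite ?mulr1 ?mulr0 ?addr0 ?expR0// addrC subrK.
Qed.

(** * Comparison of the exponential integrals *)

Section Comparison.
Context {R : realType} {d1 d2 : nat}.
Hypotheses (d1_gt0 : (0 < d1)%N) (d2_gt0 : (0 < d2)%N).
Variables (D1 : set (set (Rd R d1))) (D2 : set (set (Rd R d2))).
Hypotheses (D1_grid : dyadic_grid D1) (D2_grid : dyadic_grid D2).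
Variables (Omega : set (Rprod R d1 d2)) (U : set (rect R d1 d2)).
Hypothesis adm : admissible_pair D1 D2 Omega U.
Variable w : nat -> nat -> R.
Hypotheses (w_adm : admissible_weight w) (w_neq0 : exists a b, w a b != 0).
Local Notation la := (lebesgue_Rprod R d1 d2).
Local Notation mu := (lebesgue_Rd R d1 \x lebesgue_Rd R d2)%E.
Local Notation rs := (fun J : set (Rd R d1) * set (Rd R d2) => J.1 `*` J.2).

Let lam1 := grid_laminar d1_gt0 D1_grid.
Let lam2 := grid_laminar d2_gt0 D2_grid.

Lemma weight_le_ft a b : w a b <= fine (ft_norm w).
Proof.
apply: le_trans (ft_norm_ge w_adm 0); rewrite big_nat1.
apply: (@le_trans _ _ (w 0%N b)); first exact: (weight_nincr1 w_adm).
exact: (weight_nincr2 w_adm).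
Qed.

Lemma ft_norm_gt0 : 0 < fine (ft_norm w).
Proof.
have [a [b wab]] := w_neq0; apply: lt_le_trans (weight_le_ft a b).
by rewrite lt_def wab (weight_ge0 w_adm).
Qed.

Lemma kappa_gt0 : 0 < kappa w.
Proof. by rewrite /kappa invr_gt0 mulr_gt0// ft_norm_gt0. Qed.

Lemma kappa_ft : kappa w * fine (ft_norm w) = 160^-1.
Proof.
have := ft_norm_gt0; rewrite /kappa; set N := fine _ => N0.
by field; rewrite gt_eqF.
Qed.

Local Notation c := (t0 R * kappa w).
Local Notation W I := (rect_weight D1 D2 w I Omega).
Let b (I : rect R d1 d2) : R := expR (c * W I) - 1.

Let c_gt0 : 0 < c. Proof. by rewrite mulr_gt0 ?t0_gt0 ?kappa_gt0. Qed.

Let W_ge0 I : 0 <= W I. Proof. exact: (weight_ge0 w_adm). Qed.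

Let cW_ge0 I : 0 <= c * W I. Proof. by rewrite mulr_ge0// ltW. Qed.

Let cW_le I : c * W I <= 256^-1 / 160.
Proof.
rewrite -mulrA; apply: ler_pM; [exact/ltW/t0_gt0| |exact: t0_le|].
  by rewrite mulr_ge0// ltW// kappa_gt0.
by rewrite -kappa_ft; apply: ler_wpM2l; [exact/ltW/kappa_gt0|exact: weight_le_ft].
Qed.

Let b_ge0 I : 0 <= b I.
Proof. by rewrite subr_ge0 -[leLHS]expR0 ler_expR. Qed.

Let b_le I : b I <= 257 / 256 * (c * W I).
Proof.
(* For y = c W_I <= 1/40960, the same inequality gives exp y <= 1 / (1 - y), which is below
   257/256. *)
apply: (le_trans (expRB1_le _)); rewrite mulrC; apply: ler_wpM2r => //.
have := expRB1_le (c * W I); have := cW_le I; have := cW_ge0 I.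
have := expR_gt0 (c * W I); set y := c * W I; set E := expR y => *; nra.
Qed.

(** The Carleson constant of b is at most (257/256) t_0 kappa_w 4 ||w||_ft = (257/64) t_0 / 160,
    less than 1/10000 since t_0 <= 1/256; [exp_bound] doubles it. *)
Lemma weighted_exp_bound (V : seq (rect R d1 d2)) :
  uniq V -> (forall I, I \in V -> U I) ->
  (\int[mu]_x (expR (c * \sum_(J <- V) W J * \1_(J.1 `*` J.2) x) - 1)%:E <=
    (100^-1 / 50)%:E * mu (rect_cover V))%E.
Proof.
move=> uV VU; have VD : {in V, forall J, D1 J.1 /\ D2 J.2}.
  by move=> J /VU/(adm_rect adm)[].
have carl (V' : seq (rect R d1 d2)) : uniq V' -> {subset V' <= V} ->
    (\sum_(J <- V') (b J)%:E * mu (rs J) <=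
      (100^-1 / 100)%:E * mu (rect_cover V'))%E.
  move=> uV' V'V; have V'U I : I \in V' -> U I by move=> /V'V/VU.
  have leW := weight_carleson d1_gt0 d2_gt0 D1_grid D2_grid adm uV' V'U w_adm.
  apply: (@le_trans _ _ ((257 / 256 * c)%:E *
      \sum_(I <- V') (W I)%:E * mu (I.1 `*` I.2))%E).
    rewrite ge0_sume_distrr; last by move=> I _; rewrite mule_ge0 ?lee_fin.
    apply: lee_sum => I _; rewrite muleA -EFinM; apply: lee_wpmul2r => //.
    by rewrite lee_fin; apply: (le_trans (b_le I)); rewrite mulrA.
  have c0 : (0 <= (257 / 256 * c)%:E)%E.
    by rewrite lee_fin mulr_ge0 ?(ltW c_gt0)//; lra.
  apply: (le_trans (lee_wpmul2l c0 leW)); rewrite muleA -EFinM.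
  apply: lee_wpmul2r => //; rewrite lee_fin.
  have regroup (x y z : R) : 257 / 256 * (x * y) * (4 * z) = 257 / 64 * (x * (y * z)).
    by field.
  rewrite regroup.
  by rewrite kappa_ft; have := t0_le (R := R); lra.
rewrite (eq_integral (fun x => (wprod V rs b x - 1)%:E)); last first.
  move=> x _; rewrite (wprod_exp V rs (fun I => c * W I)) mulr_sumr.
  by congr (expR _ - 1)%:E; apply: eq_bigr => I _; rewrite mulrA.
apply: (le_trans (@exp_bound _ _ _ _ _ _ _ _ _ lam1 lam2 b b_ge0 V uV _ _ _)).
- by move=> I J /VU UI /VU UJ; exact: (admissible_incomparable adm).
- move=> J JV; have [? ?] := VD _ JV; split => //.
  by apply: (le_trans (b_le J)); have := cW_le J; lra.
- move=> V' uV' V'V; apply: (le_trans (carl _ uV' V'V)).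
  by apply: lee_wpmul2r => //; rewrite lee_fin; lra.
- apply: (@le_trans _ _ (2%:E * ((100^-1 / 100)%:E * mu (rect_cover V)))%E).
    by apply: lee_wpmul2l => //; exact: carl.
  by rewrite muleA -EFinM; apply: lee_wpmul2r => //; rewrite lee_fin; lra.
Qed.

Section Sparse.
Variables (G : seq (rect R d1 d2)) (E : rect R d1 d2 -> set (Rd R d1 * Rd R d2)).
Hypotheses (uG : uniq G) (GU : forall I, I \in G -> U I).
Hypotheses (tE : trivIset [set` G] E)
  (GE : {in G, forall J, [/\ measurable (E J), E J `<=` rs J &
      (8^-1%:E * mu (rs J) <= mu (E J))%E]}).

Let GD : {in G, forall J, D1 J.1 /\ D2 J.2}.
Proof. by move=> J /GU/(adm_rect adm)[]. Qed.

Lemma measurable_cover_sub (V : seq (rect R d1 d2)) :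
  (forall I, I \in V -> U I) -> measurable (rect_cover V).
Proof.
move=> VU; apply: measurable_rect_cover => J /VU/(adm_rect adm)[? ?].
by split; [exact: (laminar_measurable lam1)|exact: (laminar_measurable lam2)].
Qed.

Lemma sparse_carleson (V : seq (rect R d1 d2)) : uniq V -> {subset V <= G} ->
  (\sum_(J <- V) mu (rs J) <= 8%:E * mu (rect_cover V))%E.
Proof.
move=> uV VG.
apply: (@le_trans _ _ (\sum_(J <- V) 8%:E * mu (E J))%E).
  rewrite big_seq [leRHS]big_seq; apply: lee_sum => J /VG/GE[_ _].
  by rewrite lee_pdivrMl.
rewrite -ge0_sume_distrr//; apply: lee_wpmul2l => //.
have mEV : {in V, forall J, measurable (E J)} by move=> J /VG/GE[].
have -> : (\sum_(J <- V) mu (E J) = mu (\big[setU/set0]_(J <- V) E J))%E.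
  elim: V uV VG mEV => [|J V IHV]; first by rewrite !big_nil measure0.
  move=> /= /andP[JV uV] VG mEV; have mEV' : {in V, forall L, measurable (E L)}.
    by move=> L LV; apply: mEV; rewrite inE LV orbT.
  rewrite !big_cons IHV//; last by move=> L LV; apply: VG; rewrite inE LV orbT.
  rewrite measureU//.
  - by apply: mEV; exact: mem_head.
  - by rewrite big_seq; exact: bigsetU_measurable.
  - rewrite -bigcup_seq; apply/seteqP; split => // x [EJx [L /= LV ELx]].
    have JL : J = L.
      apply: (tE (i := J) (j := L)); [exact: (VG _ (mem_head _ _))| |by exists x].
      by apply: VG; rewrite inE LV orbT.
    by move: JV; rewrite JL LV.
rewrite le_measure ?inE//.
- by rewrite big_seq; exact: bigsetU_measurable.
- by apply: measurable_cover_sub => J /VG; exact: GU.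
- rewrite -bigcup_seq => x [J /= JV EJx]; exists J => //.
  by have [_ sE _] := GE (VG _ JV); exact: sE.
Qed.

Lemma exp_h_E (x : Rd R d1 * Rd R d2) :
  (expeR ((t0 R)%:E * h_ [set` G] x) - 1)%E =
  (wprod G rs (fun=> expR (t0 R) - 1) x - 1)%:E.
Proof.
rewrite (wprod_exp G rs (fun=> t0 R)) /h_ esum_fset; first last.
- by move=> I _; rewrite lee_fin.
- exact: finite_seq.
by rewrite -fsbig_seq// sumEFin -EFinM /= mulr_sumr.
Qed.

Let s_eq : expR (t0 R) - 1 = 256^-1. Proof. by rewrite expR_t0; field. Qed.

Lemma measurable_exp_h :
  measurable_fun setT (fun x : Rd R d1 * Rd R d2 =>
    (expeR ((t0 R)%:E * h_ [set` G] x) - 1)%E).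
Proof.
rewrite (_ : (fun x => _) = fun x => (wprod G rs (fun=> expR (t0 R) - 1) x - 1)%:E).
  apply/measurable_EFinP; apply: measurable_funB => //.
  by apply: measurable_wprod; exact: (measurable_rs lam1 lam2).
by apply/funext => x; exact: exp_h_E.
Qed.

Lemma exp_h_ge0 (x : Rd R d1 * Rd R d2) :
  (0 <= expeR ((t0 R)%:E * h_ [set` G] x) - 1)%E.
Proof. by rewrite exp_h_E lee_fin subr_ge0 wprod_ge1// s_eq. Qed.

(** Both hypotheses of [exp_bound] hold with equality of constants: b = 1/256, and the sparse
    constant 8 gives 8/256 = 1/32. *)
Lemma sparse_exp_le :
  (\int[la]_x (expeR ((t0 R)%:E * h_ [set` G] x) - 1) <=
    16^-1%:E * mu (rect_cover G))%E.
Proof.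
rewrite (integral_Rprod measurable_exp_h exp_h_ge0).
under eq_integral do rewrite exp_h_E s_eq.
have carl V : uniq V -> {subset V <= G} ->
    (\sum_(J <- V) 256^-1%:E * mu (rs J) <= 32^-1%:E * mu (rect_cover V))%E.
  move=> uV VG; rewrite -ge0_sume_distrr//.
  apply: (le_trans (lee_wpmul2l _ (sparse_carleson uV VG))) => //.
  by rewrite muleA -EFinM; apply: lee_wpmul2r => //; rewrite lee_fin; lra.
apply: (le_trans (@exp_bound _ _ _ _ _ _ _ _ _ lam1 lam2 (fun=> 256^-1) _ G uG _ _ carl)).
- by [].
- by move=> I J /GU UI /GU UJ; exact: (admissible_incomparable adm).
- by move=> J /GD[].
- have sG : {subset G <= G} by [].
  apply: (le_trans (lee_wpmul2l _ (carl G uG sG))) => //.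
  by rewrite muleA -EFinM; apply: lee_wpmul2r => //; rewrite lee_fin; lra.
Qed.

Lemma exp_h_ge :
  (256^-1%:E * mu (rect_cover G) <=
    \int[la]_x (expeR ((t0 R)%:E * h_ [set` G] x) - 1))%E.
Proof.
rewrite (integral_Rprod measurable_exp_h exp_h_ge0).
have mG := measurable_cover_sub GU.
have mi : measurable_fun setT (fun x => (\1_(rect_cover G) x)%:E : \bar R).
  by apply/measurable_EFinP; exact: measurable_indic.
rewrite -[in leLHS](setIT (rect_cover G)) -integral_indic// -ge0_integralZl//.
apply: ge0_le_integral => //.
- by apply: measurable_funeM; exact: mi.
- exact: measurable_exp_h.
move=> x _; have [[J JG Jx]|nGx] := pselect (rect_cover G x); last first.
  by rewrite indicE memNset// mule0 exp_h_ge0.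
rewrite indicE mem_set; last by exists J.
rewrite mule1 exp_h_E lee_fin s_eq (wprod_rem _ _ _ JG).
rewrite indicE mem_set// mulr1.
have : 1 <= wprod (rem J G) rs (fun=> 256^-1 : R) x by exact: wprod_ge1.
by set p := wprod _ _ _ _ => p1; lra.
Qed.

End Sparse.

End Comparison.

Theorem theorem4p8 (R : realType) (d1 d2 : nat)
    (d1_gt0 : (0 < d1)%N) (d2_gt0 : (0 < d2)%N)
    (D1 : set (set (Rd R d1))) (D2 : set (set (Rd R d2)))
    (D1_grid : dyadic_grid D1) (D2_grid : dyadic_grid D2)
    (Omega : set (Rprod R d1 d2)) (U : set (rect R d1 d2))
    (OmegaU_adm : admissible_pair D1 D2 Omega U)
    (w : nat -> nat -> R) (w_adm : admissible_weight w)
    (w_neq0 : exists a b, w a b != 0) :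
  (exists G0 : set (rect R d1 d2),
    [/\ G0 `<=` U,
        sparse 8^-1 G0,
        (\int[lebesgue_Rprod R d1 d2]_x
            (expeR ((t0 R * kappa w)%:E * H_ D1 D2 Omega U w x) - 1)
         <= \int[lebesgue_Rprod R d1 d2]_x (expeR ((t0 R)%:E * h_ G0 x) - 1))%E
      & (\int[lebesgue_Rprod R d1 d2]_x (expeR ((t0 R)%:E * h_ G0 x) - 1)
         <= 16^-1%:E * lebesgue_Rprod R d1 d2 (sh G0))%E]) /\
  (\int[lebesgue_Rprod R d1 d2]_(x in Omega)
      expeR ((t0 R * kappa w)%:E * H_ D1 D2 Omega U w x)
   <= (17 / 16)%:E * lebesgue_Rprod R d1 d2 Omega)%E.
Proof.
have lam1 := grid_laminar d1_gt0 D1_grid.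
have lam2 := grid_laminar d2_gt0 D2_grid.
have UD := adm_rect OmegaU_adm.
have cU : countable U.
  exact: sub_countable (subset_card_le UD) (countable_rects d1_gt0 d2_gt0 D1_grid D2_grid).
have [e [ue eU emono Ue]] := countable_exhaustion cU.
have [mU cvgU] := exhausted_cover_cvg d1_gt0 d2_gt0 D1_grid D2_grid UD eU emono Ue.
pose mu := (lebesgue_Rd R d1 \x lebesgue_Rd R d2)%E.
have me n : measurable (rect_cover (e n)).
  exact: (measurable_cover_sub d1_gt0 d2_gt0 D1_grid D2_grid OmegaU_adm (eU n)).
have sub_sh n : rect_cover (e n) `<=` sh U.
  by move=> x [J /eU UJ Jx]; exists J.
have shO : sh U `<=` Omega by move=> x [J UJ Jx]; exact: (adm_sub OmegaU_adm UJ).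
have c_gt0 : 0 < t0 R * kappa w by rewrite mulr_gt0 ?t0_gt0 ?(kappa_gt0 w_adm w_neq0).
have W_ge0 J : 0 <= rect_weight D1 D2 w J Omega by exact: (weight_ge0 w_adm).
pose v (x : Rd R d1 * Rd R d2) (J : rect R d1 d2) : R :=
  rect_weight D1 D2 w J Omega * \1_(J.1 `*` J.2) x.
have v_ge0 x J : 0 <= v x J by rewrite mulr_ge0.
pose f n (x : Rd R d1 * Rd R d2) : \bar R :=
  (expR (t0 R * kappa w * \sum_(J <- e n) v x J) - 1)%:E.
pose F (x : Rd R d1 * Rd R d2) : \bar R :=
  (expeR ((t0 R * kappa w)%:E * H_ D1 D2 Omega U w x) - 1)%E.
have cvgF x : f n x @[n --> \oo] --> F x.
  exact: (cvg_exp_esum ue eU emono Ue c_gt0 (v_ge0 x)).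
have mf n : measurable_fun setT (f n).
  rewrite (_ : f n = fun x => (wprod (e n) (fun J => J.1 `*` J.2)
      (fun J => expR (t0 R * kappa w * rect_weight D1 D2 w J Omega) - 1) x - 1)%:E).
    apply/measurable_EFinP; apply: measurable_funB => //.
    apply: measurable_wprod => J /eU/UD.
    exact: (measurable_rect d1_gt0 d2_gt0 D1_grid D2_grid).
  apply/funext => x; rewrite /f wprod_exp mulr_sumr.
  by congr (expR _ - 1)%:E; apply: eq_bigr => J _; rewrite mulrA.
have f_ge0 n x : (0 <= f n x)%E.
  rewrite lee_fin subr_ge0 -[leLHS]expR0 ler_expR; apply: mulr_ge0; first exact: ltW.
  exact: sumr_ge0.
have f_nd x : {homo f^~ x : n k / (n <= k)%N >-> (n <= k)%E}.
  move=> n k nk; rewrite lee_fin lerD2r ler_expR ler_pM2l//.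
  exact: (sum_exhaustion_le ue emono).
have mF : measurable_fun setT F.
  by apply: (emeasurable_fun_cvg f) => // x _; exact: cvgF.
have F_ge0 x : (0 <= F x)%E.
  rewrite -(cvg_lim _ (cvgF x))//; apply: lime_ge.
    by apply/cvg_ex; eexists; exact: cvgF.
  exact: nearW.
have leF : (\int[mu]_x F x <= (100^-1 / 50)%:E * mu (sh U))%E.
  rewrite (eq_integral (fun x => limn (f^~ x))); last first.
    by move=> x _; rewrite (cvg_lim _ (cvgF x)).
  rewrite monotone_convergence//; apply: lime_le.
    apply: ereal_nondecreasing_is_cvgn => n k nk.
    by apply: ge0_le_integral => // x _; exact: f_nd.
  apply: nearW => n; apply: le_trans.
    exact: (weighted_exp_bound d1_gt0 d2_gt0 D1_grid D2_grid OmegaU_adm w_adm w_neq0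
      (ue n) (eU n)).
  apply: lee_wpmul2l; first by rewrite lee_fin; lra.
  by apply: le_measure; rewrite ?inE.
have leshO : (mu (sh U) <= lebesgue_Rprod R d1 d2 Omega)%E.
  by rewrite /mu -lebesgue_RprodE//; exact: le_outer_measure.
have fU : mu (sh U) \is a fin_num.
  by rewrite ge0_fin_numE ?(le_lt_trans leshO) ?(adm_finite OmegaU_adm)// measure_ge0.
(* Selection needs a finite list, hence the loss 10/9. If sh U is null, the strict inequality in
   [small] is already absurd. *)
have [n le_n] : exists n, ((9 / 10)%:E * mu (sh U) <= mu (rect_cover (e n)))%E.
  apply: contrapT => /forallNP small.
  have {}small n : (mu (rect_cover (e n)) < (9 / 10)%:E * mu (sh U))%E.
    by rewrite ltNge; apply/negP; exact: small.
  have : (mu (sh U) <= (9 / 10)%:E * mu (sh U))%E.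
    rewrite -[leLHS](cvg_lim _ cvgU)//; apply: lime_le.
      by apply/cvg_ex; eexists; exact: cvgU.
    by apply: nearW => n; exact: ltW.
  have := small 0%N; have : (0 <= mu (rect_cover (e 0%N)))%E by exact: measure_ge0.
  move=> p0 /(le_lt_trans p0); rewrite -(fineK fU) -EFinM lee_fin lte_fin => *; lra.
have VD : {in e n, forall J, D1 J.1 /\ D2 J.2} by move=> J /eU/UD[].
have [G [E [[Ge uG] tE GE VG]]] := sparse_selection lam1 lam2 (ue n) VD.
have GU J : J \in G -> U J by move=> /Ge/eU.
have mG := measurable_cover_sub d1_gt0 d2_gt0 D1_grid D2_grid OmegaU_adm GU.
have leG : (mu (rect_cover (e n)) <= 16%:E * mu (rect_cover G))%E.
  apply: (strong_cover lam1 lam2) => // J Je; have [? ?] := VD _ Je.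
  by split => //; exact: VG.
have shG : sh [set` G] = rect_cover G by [].
have laG : lebesgue_Rprod R d1 d2 (sh [set` G]) = mu (rect_cover G).
  by rewrite shG lebesgue_RprodE.
have leh := sparse_exp_le d1_gt0 d2_gt0 D1_grid D2_grid OmegaU_adm uG GU tE GE.
have geh := exp_h_ge d1_gt0 d2_gt0 D1_grid D2_grid OmegaU_adm uG GU.
have leFh : (\int[lebesgue_Rprod R d1 d2]_x F x <=
    \int[lebesgue_Rprod R d1 d2]_x (expeR ((t0 R)%:E * h_ [set` G] x) - 1))%E.
  apply: le_trans geh; rewrite (integral_Rprod mF F_ge0); apply: (le_trans leF).
  have fG : mu (rect_cover G) \is a fin_num.
    rewrite ge0_fin_numE ?measure_ge0//; apply: (@le_lt_trans _ _ (mu (sh U))).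
      apply: le_measure; rewrite ?inE// => x [J /GU UJ Jx]; by exists J.
    by rewrite -ge0_fin_numE ?measure_ge0.
  (* The bound |sh U| <= (160/9) |sh G| turns 1/5000 into 4/1125, which is less than 1/256. *)
  have := le_trans le_n leG; rewrite -/mu -(fineK fU) -(fineK fG) -!EFinM !lee_fin.
  have : 0 <= fine (mu (rect_cover G)) by rewrite fine_ge0 ?measure_ge0.
  move: (fine _) (fine _) => X Y *; lra.
split.
  exists [set` G]; split; first by move=> J /GU.
  - exists E; split => // J JG; have [mE sE leE] := GE _ JG.
    have mJ := measurable_rect d1_gt0 d2_gt0 D1_grid D2_grid (UD _ (GU _ JG)).
    split => //; first exact: measurable_Rprod.
    by rewrite (lebesgue_RprodE mE) [lebesgue_Rprod _ _ _ _](lebesgue_RprodE mJ).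
  - exact: leFh.
  - by rewrite laG.
have mO := adm_measurable OmegaU_adm.
have mF' := measurable_fun_Rprod mF.
pose F' : Rprod R d1 d2 -> \bar R := F.
(* The exponential equals F + 1 also where H_w is infinite, since 1 is finite. The summand 1 yields
   |Omega|, and the integral of F is at most 1/16 of |sh G|. *)
rewrite [leLHS](_ : _ =
    \int[lebesgue_Rprod R d1 d2]_(x in Omega) (F' x + cst 1 x))%E; last first.
  by apply: eq_integral => x _; rewrite /F' /F subeK.
rewrite ge0_integralD//; last exact: measurable_funTS.
rewrite integral_cst// mul1e.
have -> : (17 / 16 = 16^-1 + 1 :> R) by field.
rewrite EFinD ge0_muleDl// mul1e; apply: leeD => //.
apply: (@le_trans _ _ (\int[lebesgue_Rprod R d1 d2]_x F x)%E).
  exact: ge0_subset_integral.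
apply: (le_trans leFh); apply: (le_trans leh); apply: lee_wpmul2l => //.
apply: le_trans leshO; apply: le_measure; rewrite ?inE// => x [J /GU UJ Jx].
by exists J.
Qed.
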